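(* Let $A$ be a finite dimensional basic algebra over a field $K$. Suppose that $U$ and $V$ are two finitely generated right $A$-modules with the same Newton polytope, i.e. $\mathcal N(U)=\mathcal N(V)$. Then the following statements hold. (i) For any $\tau$-tilting pair $(M,P)$, $U\in\mathsf{Fac}\,M$ if and only if $V\in\mathsf{Fac}\,M$. (ii) If $U$ and $V$ are left finite, then $\langle U\rangle_{\rm tors}=\langle V\rangle_{\rm tors}$. (iii) If $U$ and $V$ are left finite bricks, then $U\cong V$. (iv) If $U$ and $V$ are indecomposable $\tau$-rigid modules, then $U\cong V$. (v) If $U$ and $V$ are $\tau$-rigid modules, then $U\oplus V$ is $\tau$-rigid.
   Context: $\mathsf{mod}\,A$ is the category of finitely generated right $A$-modules, $\tau$ is the Auslander-Reiten translation in $\mathsf{mod}\,A$, and $n$ is the number of isomorphism classes of simple $A$-modules. The dimension vector of a module $X\in\mathsf{mod}\,A$ is the vector in $\mathbb Z_{\ge 0}^n$ whose $i$-th entry is the multiplicity of the $i$-th simple module as a composition factor of $X$. Newton polytope: for $U\in\mathsf{mod}\,A$, $\mathcal N(U)\subset\mathbb R^n$ is the convex hull of the dimension vectors of all quotient modules of $U$. For $M\in\mathsf{mod}\,A$: $\mathsf{add}\,M$ is the additive closure of $M$ (direct summands of finite direct sums of copies of $M$); $\mathsf{Fac}\,M$ is the class of factor modules of modules in $\mathsf{add}\,M$; $|M|$ is the number of pairwise non-isomorphic indecomposable direct summands of $M$ (so $|A|=n$). $M\in\mathsf{mod}\,A$ is $\tau$-rigid if $\operatorname{Hom}_A(M,\tau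 M)=0$. A pair $(M,P)$ with $M\in\mathsf{mod}\,A$ and $P\in\mathsf{mod}\,A$ projective is $\tau$-rigid if $M$ is $\tau$-rigid and $\operatorname{Hom}_A(P,M)=0$; it is $\tau$-tilting if it is $\tau$-rigid and $|M|+|P|=|A|$. A torsion class is a full subcategory of $\mathsf{mod}\,A$ closed under quotients and extensions; it is functorially finite if it equals $\mathsf{Fac}\,M$ for some $M\in\mathsf{mod}\,A$. For $N\in\mathsf{mod}\,A$, $\langle N\rangle_{\rm tors}$ is the smallest torsion class containing $N$. The module $N$ is left finite if $\langle N\rangle_{\rm tors}$ is functorially finite. A module $S\in\mathsf{mod}\,A$ is a brick if $\operatorname{End}_A(S)$ is a division algebra. *)

(* Defs.v *)
From HB Require Import structures.
From mathcomp Require Import all_boot all_order all_algebra all_field.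
From mathcomp Require Import boolp classical_sets reals convex.

Set Implicit Arguments.
Unset Strict Implicit.
Unset Printing Implicit Defensive.

Import GRing.Theory.
Local Open Scope classical_set_scope.
Local Open Scope ring_scope.

(* Over a finite dimensional K-algebra, a module is finitely generated if and  *)
(* only if it is finite dimensional over K, so finitely generated modules are  *)
(* represented by vectTypes with an action that is bilinear over K.            *)
Record rmod (K : fieldType) (A : falgType K) := RMod {
  rcarrier :> vectType K;
  ract : rcarrier -> A -> rcarrier;
  ract_linearl : forall a, linear (ract ^~ a);
  ract_linearr : forall x, linear (ract x);
  ract1 : forall x, ract x 1 = x;
  ractM : forall x a b, ract x (a * b) = ract (ract x a) b
}.

Record lmod (K : fieldType) (A : falgType K) := LMod {
  lcarrier :> vectType K;
  lact : A -> lcarrier -> lcarrier;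
  lact_linearl : forall x, linear (lact ^~ x);
  lact_linearr : forall a, linear (lact a);
  lact1 : forall x, lact 1 x = x;
  lactM : forall a b x, lact (a * b) x = lact a (lact b x)
}.

Section RightModules.
Variables (K : fieldType) (A : falgType K).
Implicit Types (L : lmod A) (M N P T U V X Y Z : rmod A).

Definition rhom U V (f : 'Hom(U, V)) : Prop :=
  forall x a, f (ract x a) = ract (f x) a.

Definition lhom (L L' : lmod A) (f : 'Hom(L, L')) : Prop :=
  forall a x, f (lact a x) = lact a (f x).

Definition is_epi (X Y : vectType K) (f : 'Hom(X, Y)) : Prop :=
  limg f = fullv.

Definition is_mono (X Y : vectType K) (f : 'Hom(X, Y)) : Prop :=
  lker f = 0%VS.

Definition hom_zero U V : Prop := forall f : 'Hom(U, V), rhom f -> f = 0.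

Definition riso U V : Prop :=
  exists f : 'Hom(U, V), [/\ rhom f, is_mono f & is_epi f].

Definition zeromod U : Prop := \dim {:U} = 0%N.

Definition submodule U (W : {vspace U}) : Prop :=
  forall x a, x \in W -> ract x a \in W.

Definition simple_module U : Prop :=
  ~ zeromod U /\
  forall W : {vspace U}, submodule W -> W = 0%VS \/ W = fullv.

Definition brick U : Prop :=
  ~ zeromod U /\
  forall f : 'End(U), rhom f -> f != 0 ->
    exists g : 'End(U), [/\ rhom g, (g \o f = \1)%VF & (f \o g = \1)%VF].

Fact reg_linearl (a : A) : linear ( *%R^~ a).
Proof. by move=> k x y; rewrite mulrDl scalerAl. Qed.

Fact reg_linearr (x : A) : linear ( *%R x).
Proof. by move=> k a b; rewrite mulrDr scalerAr. Qed.

Definition regmod : rmod A := @RMod K A A (fun x a => x * a)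
  reg_linearl reg_linearr (@mulr1 A) (@mulrA A).

Section DirectSum.
Variables U V : rmod A.
Definition dsum_act (x : (U * V)%type) (a : A) : (U * V)%type :=
  (ract x.1 a, ract x.2 a).
Fact dsum_linearl a : linear (dsum_act ^~ a).
Proof. by move=> k x y; congr pair; rewrite /= ract_linearl. Qed.
Fact dsum_linearr x : linear (dsum_act x).
Proof. by move=> k a b; congr pair; rewrite /= ract_linearr. Qed.
Fact dsum_act1 x : dsum_act x 1 = x.
Proof. by case: x => u v; congr pair; rewrite /= ract1. Qed.
Fact dsum_actM x a b : dsum_act x (a * b) = dsum_act (dsum_act x a) b.
Proof. by congr pair; rewrite /= ractM. Qed.
Definition dsum : rmod A :=
  RMod dsum_linearl dsum_linearr dsum_act1 dsum_actM.
End DirectSum.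

Section Power.
Variables (U : rmod A) (k : nat).
Definition power_act (x : {ffun 'I_k -> U}) (a : A) : {ffun 'I_k -> U} :=
  [ffun i => ract (x i) a].
Fact power_linearl a : linear (power_act ^~ a).
Proof. by move=> c x y; apply/ffunP => i; rewrite !ffunE ract_linearl. Qed.
Fact power_linearr x : linear (power_act x).
Proof. by move=> c a b; apply/ffunP => i; rewrite !ffunE ract_linearr. Qed.
Fact power_act1 x : power_act x 1 = x.
Proof. by apply/ffunP => i; rewrite !ffunE ract1. Qed.
Fact power_actM x a b : power_act x (a * b) = power_act (power_act x a) b.
Proof. by apply/ffunP => i; rewrite !ffunE ractM. Qed.
Definition power_mod : rmod A :=
  RMod power_linearl power_linearr power_act1 power_actM.
End Power.

Definition summand Y X : Prop := exists Z, riso X (dsum Y Z).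

Definition indecomposable X : Prop :=
  ~ zeromod X /\ forall Y Z, riso X (dsum Y Z) -> zeromod Y \/ zeromod Z.

Definition is_dsum (k : nat) (Y : 'I_k -> rmod A) X : Prop :=
  exists (i : forall j, 'Hom(Y j, X)) (p : forall j, 'Hom(X, Y j)),
  [/\ forall j, rhom (i j) /\ rhom (p j),
      forall j, (p j \o i j = \1)%VF,
      forall j l, j != l -> (p l \o i j = 0)%VF
    & (\sum_j (i j \o p j) = \1)%VF].

Definition pairwise_noniso (k : nat) (Y : 'I_k -> rmod A) : Prop :=
  forall j l, riso (Y j) (Y l) -> j = l.

Definition basic_algebra : Prop :=
  exists (k : nat) (Y : 'I_k -> rmod A),
  [/\ forall j, indecomposable (Y j), pairwise_noniso Y & is_dsum Y regmod].

(* |X| = k *)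
Definition num_indec X (k : nat) : Prop :=
  exists Y : 'I_k -> rmod A,
  [/\ forall j, indecomposable (Y j) /\ summand (Y j) X,
      pairwise_noniso Y
    & forall Z, indecomposable Z -> summand Z X -> exists j, riso Z (Y j)].

Definition in_add M X : Prop := exists k, summand X (power_mod M k).

Definition Fac M X : Prop :=
  exists N (f : 'Hom(N, X)), [/\ in_add M N, rhom f & is_epi f].

Definition torsion_class (T : rmod A -> Prop) : Prop :=
  (forall X Y (f : 'Hom(X, Y)), rhom f -> is_epi f -> T X -> T Y) /\
  (forall X Y Z (f : 'Hom(X, Y)) (g : 'Hom(Y, Z)),
     rhom f -> rhom g -> is_mono f -> is_epi g -> limg f = lker g ->
     T X -> T Z -> T Y).

Definition tors N X : Prop :=
  forall T : rmod A -> Prop, torsion_class T -> T N -> T X.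

Definition same_class (T T' : rmod A -> Prop) : Prop :=
  forall X, T X <-> T' X.

Definition functorially_finite (T : rmod A -> Prop) : Prop :=
  exists M, same_class T (Fac M).

Definition left_finite N : Prop := functorially_finite (tors N).

Definition projective P : Prop :=
  forall X Y (g : 'Hom(X, Y)) (h : 'Hom(P, Y)), rhom g -> is_epi g -> rhom h ->
  exists2 h' : 'Hom(P, X), rhom h' & (g \o h' = h)%VF.

(* f induces a projective cover of the submodule W *)
Definition proj_cover P X (f : 'Hom(P, X)) (W : {vspace X}) : Prop :=
  [/\ projective P, rhom f, limg f = W
    & forall Q : {vspace P}, submodule Q -> (f @: Q = W)%VS -> Q = fullv].

Definition min_proj_presentation P1 P0 M
    (f : 'Hom(P1, P0)) (g : 'Hom(P0, M)) : Prop :=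
  proj_cover g fullv /\ proj_cover f (lker g).

Definition ractE U (a : A) : 'End(U) := linfun (fun x : U => ract x a).

Lemma ractEE U a (x : U) : ractE U a x = ract x a.
Proof.
pose r := GRing.isLinear.Build K U U *:%R (fun x : U => ract x a)
  (@ract_linearl K A U a).
pose f : {linear U -> U} := HB.pack (fun x : U => ract x a) r.
exact: (lfunE f x).
Qed.

Definition hom_defect U V (a : A) (f : 'Hom(U, V)) : 'Hom(U, V) :=
  ((f \o ractE U a) - (ractE V a \o f))%VF.

Lemma hom_defectE U V a (f : 'Hom(U, V)) x :
  hom_defect a f x = f (ract x a) - ract (f x) a.
Proof. by rewrite /hom_defect lfun_simp !comp_lfunE opp_lfunE comp_lfunE !ractEE. Qed.

Lemma hom_defect_linear U V a : linear (@hom_defect U V a).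
Proof.
move=> k f g; apply/lfunP => x.
rewrite !(hom_defectE, add_lfunE, scale_lfunE) ract_linearl.
by rewrite opprD addrACA scalerBr.
Qed.

HB.instance Definition _ U V a := GRing.isLinear.Build K _ _ *:%R
  (@hom_defect U V a) (@hom_defect_linear U V a).

(* Hom_A(U, V): A-linearity only needs to be tested on a K-basis of A. *)
Definition homA U V : {vspace 'Hom(U, V)} :=
  (\bigcap_(i < \dim {:A}) lker (linfun (@hom_defect U V (vbasis {:A})`_i)))%VS.

Lemma homAP U V (f : 'Hom(U, V)) : reflect (rhom f) (f \in homA U V).
Proof.
rewrite memvE; apply: (iffP subv_bigcapP) => [fP x a | fP i _]; last first.
  rewrite -memvE memv_ker lfunE /=; apply/eqP/lfunP => x.
  by rewrite hom_defectE fP subrr zero_lfunE.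
have fb i : hom_defect (vbasis {:A})`_i f x = 0 :> V.
  have [ltid | leid] := ltnP i (\dim {:A}); last first.
    have -> : (vbasis {:A})`_i = 0 by rewrite nth_default ?size_tuple.
    have r0 W (y : rcarrier W) : ract y 0 = 0.
      by have := ract_linearr y (-1) 0 0; rewrite scaler0 addr0 scaleN1r addNr.
    by rewrite hom_defectE !r0 linear0 subrr.
  have := fP (Ordinal ltid) isT; rewrite -memvE memv_ker lfunE /= => /eqP->.
  by rewrite zero_lfunE.
rewrite [a](coord_vbasis (memvf a)).
pose gl := GRing.isLinear.Build K A V *:%R _ (ract_linearr (f x)).
pose g : {linear A -> V} := HB.pack (ract (f x)) gl.
pose hl := GRing.isLinear.Build K A U *:%R _ (ract_linearr x).
pose h : {linear A -> U} := HB.pack (ract x) hl.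
rewrite -[ract x _]/(h _) -[ract (f x) _]/(g _) !linear_sum.
apply: eq_bigr => i _; rewrite !linearZ; congr (_ *: _).
by apply/eqP; rewrite -subr_eq0; rewrite -[h _]/(ract x _) -hom_defectE fb.
Qed.

(* The left A-module Hom_A(P, A) *)
Section Star.
Variable P : rmod A.
Definition star_carrier : vectType K := subvs_of (homA P regmod).

Fact star_act_in (a : A) (f : star_carrier) :
  ((amull a : 'Hom(regmod, regmod)) \o vsval f)%VF \in homA P regmod.
Proof.
apply/homAP => x b; have /homAP fP := valP f.
by rewrite !comp_lfunE fP !lfunE /= mulrA.
Qed.

Definition star_act (a : A) (f : star_carrier) : star_carrier :=
  Subvs (star_act_in a f).

Fact star_actE a f x : vsval (star_act a f) x = a * (vsval f x : A).
Proof. by rewrite comp_lfunE lfunE. Qed.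

Fact star_linearl f : linear (star_act ^~ f).
Proof.
move=> k a b; apply/val_inj/lfunP => x.
rewrite star_actE linearP add_lfunE scale_lfunE !star_actE.
by rewrite mulrDl scalerAl.
Qed.

Fact star_linearr a : linear (star_act a).
Proof.
move=> k f g; apply/val_inj/lfunP => x.
rewrite star_actE !linearP !add_lfunE !scale_lfunE !star_actE.
by rewrite mulrDr scalerAr.
Qed.

Fact star_act1 f : star_act 1 f = f.
Proof. by apply/val_inj/lfunP => x; rewrite star_actE mul1r. Qed.

Fact star_actM a b f : star_act (a * b) f = star_act a (star_act b f).
Proof. by apply/val_inj/lfunP => x; rewrite !star_actE mulrA. Qed.

Definition star : lmod A :=
  LMod star_linearl star_linearr star_act1 star_actM.
End Star.

(* The right A-module D L = Hom_K(L, K) *)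
Section Dual.
Variable L : lmod A.

Definition lactE (a : A) : 'End(L) := linfun (fun x : L => lact a x).

Fact lactEE a (x : L) : lactE a x = lact a x.
Proof.
pose r := GRing.isLinear.Build K L L *:%R _ (@lact_linearr K A L a).
pose f : {linear L -> L} := HB.pack (fun x : L => lact a x) r.
exact: (lfunE f x).
Qed.

Definition dual_act (f : 'Hom(L, K^o)) (a : A) : 'Hom(L, K^o) :=
  (f \o lactE a)%VF.

Fact dual_actE f a x : dual_act f a x = f (lact a x).
Proof. by rewrite comp_lfunE lactEE. Qed.

Fact dual_linearl a : linear (dual_act ^~ a).
Proof.
by move=> k f g; apply/lfunP => x; rewrite !(dual_actE, add_lfunE, scale_lfunE).
Qed.

Fact dual_linearr f : linear (dual_act f).
Proof.
move=> k a b; apply/lfunP => x.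
by rewrite !(dual_actE, add_lfunE, scale_lfunE) lact_linearl linearP.
Qed.

Fact dual_act1 f : dual_act f 1 = f.
Proof. by apply/lfunP => x; rewrite dual_actE lact1. Qed.

Fact dual_actM f a b : dual_act f (a * b) = dual_act (dual_act f a) b.
Proof. by apply/lfunP => x; rewrite !dual_actE lactM. Qed.

Definition kdual : rmod A :=
  RMod dual_linearl dual_linearr dual_act1 dual_actM.
End Dual.

(* L = Tr M: there is an exact sequence Hom(P0, A) -> Hom(P1, A) -> L -> 0,    *)
(* with first map h |-> h \o f for P1 -f-> P0 -g-> M -> 0 minimal.             *)
Definition is_transpose M (L : lmod A) : Prop :=
  exists P1 P0 (f : 'Hom(P1, P0)) (g : 'Hom(P0, M)) (p : 'Hom(star P1, L)),
  [/\ min_proj_presentation f g, lhom p, is_epi p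
    & forall h : star P1, p h = 0 <->
        exists h0 : star P0, vsval h = (vsval h0 \o f)%VF].

(* Tr M, hence tau M = D Tr M, is only determined up to isomorphism. *)
Definition is_tau M T : Prop :=
  exists2 L, is_transpose M L & riso T (kdual L).

Definition tau_rigid M : Prop := exists2 T, is_tau M T & hom_zero M T.

Definition tau_rigid_pair M P : Prop :=
  [/\ projective P, tau_rigid M & hom_zero P M].

Definition tau_tilting_pair M P : Prop :=
  tau_rigid_pair M P /\
  exists m p, [/\ num_indec M m, num_indec P p & num_indec regmod (m + p)].

Definition simple_reps (n : nat) (S : 'I_n -> rmod A) : Prop :=
  [/\ forall i, simple_module (S i), pairwise_noniso S
    & forall X, simple_module X -> exists i, riso X (S i)].

(* W <= W' are submodules of X with W' / W isomorphic to S: some linear map    *)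
(* X -> S is A-linear on W' and maps W' onto S with kernel W.                  *)
Definition subquotient_iso X (W W' : {vspace X}) (S : rmod A) : Prop :=
  exists f : 'Hom(X, S),
  [/\ forall x a, x \in W' -> f (ract x a) = ract (f x) a,
      (f @: W')%VS = fullv & (W' :&: lker f)%VS = W].

(* F 0 <= ... <= F l is a composition series of X, and d i counts its factors  *)
(* isomorphic to S i.                                                          *)
Definition has_dimvec (n : nat) (S : 'I_n -> rmod A) X (d : 'I_n -> nat) : Prop :=
  exists (l : nat) (F : nat -> {vspace X}) (s : 'I_l -> 'I_n),
  [/\ F 0%N = 0%VS, F l = fullv, forall k, (k <= l)%N -> submodule (F k),
      forall k : 'I_l, subquotient_iso (F k) (F k.+1) (S (s k))
    & forall i, d i = #|[set k | s k == i]%SET|].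

Definition quotient_dimvecs (R : realType) (n : nat) (S : 'I_n -> rmod A) U :
    set 'rV[R]_n :=
  [set v | exists X (f : 'Hom(U, X)) d,
     [/\ rhom f, is_epi f, has_dimvec S X d & v = \row_i (d i)%:R]].

Definition newton (R : realType) (n : nat) (S : 'I_n -> rmod A) U :
    set 'rV[R]_n :=
  smallest (@convex_set R 'rV[R]_n) (@quotient_dimvecs R n S U).

End RightModules.

Arguments quotient_dimvecs {K A} R {n} S U _.
Arguments newton {K A} R {n} S U _.

(* Main.v *)
Require Import Defs.
From HB Require Import structures.
From mathcomp Require Import all_boot all_order all_algebra all_field.
From mathcomp Require Import boolp classical_sets reals convex.
From mathcomp Require Import interval_inference.

(* For a projective presentation P1 -f-> P0 -g-> M -> 0, put
   theta(X) = dim Hom(P0, X) - dim Hom(P1, X), a linear form in the dimension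
   vector of X. If the presentation is minimal and M is tau-rigid, then
   theta(X) = dim Hom(M, X) - dim Hom(X, tau M), which is positive for X <> 0
   in Fac M and nonpositive when Hom(M, X) = 0. If U lies in Fac M, then so do
   its quotients, hence theta > 0 on N(U) \ {0}. The quotient Y of V by its
   trace of M satisfies Hom(M, Y) = 0 and has its dimension vector in
   N(V) = N(U), so Y = 0 and V lies in Fac M. This gives (i) for every
   tau-rigid M. Taking M = U and M = V, it gives Fac U = Fac V for tau-rigid U
   and V, hence (v), and (iv) by Nakayama's lemma over the local ring End(U).
   If U is left finite, its torsion class is Fac N for the target N of a minimal
   left approximation of A; N is Ext-projective in this class, hence tau-rigid,
   and (ii) follows. Over a torsion class generated by a brick S, nonzero maps
   to S are onto, whence (iii). *)

Set Implicit Arguments.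
Unset Strict Implicit.
Unset Printing Implicit Defensive.

Import Order.TTheory GRing.Theory Num.Theory.
Local Open Scope ring_scope.

(** * Linear algebra: onto and injective maps, quotient spaces, composition as a linear map *)

Section LinearMaps.
Variable K : fieldType.
Implicit Types X Y Z : vectType K.

Lemma linfun_linE X Y (f : X -> Y) : linear f -> linfun f =1 f.
Proof.
move=> lin_f x.
pose m := GRing.isLinear.Build K X Y *:%R f lin_f.
pose g : {linear X -> Y} := HB.pack f m.
exact: (lfunE g x).
Qed.

Lemma epiP X Y (f : 'Hom(X, Y)) : is_epi f <-> forall y, exists x, f x = y.
Proof.
split=> [fE y | fP].
  have /memv_imgP[x _ ->] : y \in limg f by rewrite (fE : limg f = _) memvf.
  by exists x.
apply/vspaceP => y; rewrite memvf; have [x <-] := fP y.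
by rewrite memv_img ?memvf.
Qed.

Lemma monoP X Y (f : 'Hom(X, Y)) : is_mono f <-> injective f.
Proof. by split=> [f0|f_inj]; [apply/lker0P/eqP | apply/eqP/lker0P]. Qed.

Lemma mono_epi_dim X Y (f : 'Hom(X, Y)) :
  is_mono f -> (\dim {:Y} <= \dim {:X})%N -> is_epi f.
Proof.
move=> f0 le_d; apply/eqP; rewrite eqEdim subvf /=.
by rewrite (limg_dim_eq (f := f)) ?f0 ?capv0.
Qed.

Lemma epi_mono_dim X Y (f : 'Hom(X, Y)) :
  is_epi f -> (\dim {:X} <= \dim {:Y})%N -> is_mono f.
Proof.
move=> fE le_d; apply/eqP; rewrite -dimv_eq0 -leqn0.
have := limg_ker_dim f fullv; rewrite capfv (fE : limg f = _) => dE.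
by rewrite -(leq_add2r (\dim {:Y})) dE.
Qed.

Lemma epi_dim X Y (f : 'Hom(X, Y)) : is_epi f -> (\dim {:Y} <= \dim {:X})%N.
Proof.
move=> fE; rewrite -[X in (X <= _)%N](congr1 _ fE).
by rewrite -(limg_ker_dim f fullv) leq_addl.
Qed.

Lemma comp_epi X Y Z (f : 'Hom(X, Y)) (g : 'Hom(Y, Z)) :
  is_epi f -> is_epi g -> is_epi (g \o f)%VF.
Proof. by rewrite /is_epi limg_comp => ->. Qed.

(** The map [\1 - projv W] has kernel W, so its image serves as a model of X / W. *)
Lemma linear_quotient_exists X (W : {vspace X}) :
  exists (C : vectType K) (p : 'Hom(X, C)), is_epi p /\ lker p = W.
Proof.
pose r : 'End(X) := (\1 - projv W)%VF.
have rE x : (r x == 0) = (x \in W).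
  rewrite add_lfunE id_lfunE opp_lfunE subr_eq0.
  by apply/eqP/idP => [->|xW]; rewrite ?memv_proj ?projv_id.
pose C : vectType K := subvs_of (limg r).
pose p : 'Hom(X, C) := (linfun (vsproj (limg r)) \o r)%VF.
have vpE x : vsval (p x) = r x.
  by rewrite comp_lfunE lfunE /= vsprojK // memv_img ?memvf.
exists C, p; split.
  apply/epiP => y; have /memv_imgP[x _ yE] := subvsP y.
  by exists x; apply/val_inj; rewrite /= vpE.
apply/vspaceP => x; rewrite memv_ker -rE -vpE.
by apply/eqP/eqP => [->|px0] //; apply/val_inj.
Qed.

Definition precomp X Y Z (f : 'Hom(X, Y)) : 'Hom('Hom(Y, Z), 'Hom(X, Z)) :=
  linfun (fun h => (h \o f)%VF).

Lemma precompE X Y Z (f : 'Hom(X, Y)) (h : 'Hom(Y, Z)) :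
  precomp Z f h = (h \o f)%VF.
Proof.
rewrite /precomp linfun_linE // => k g g'.
by rewrite comp_lfunDl comp_lfunZl.
Qed.

Definition postcomp X Y Z (f : 'Hom(Y, Z)) : 'Hom('Hom(X, Y), 'Hom(X, Z)) :=
  linfun (fun h => (f \o h)%VF).

Lemma postcompE X Y Z (f : 'Hom(Y, Z)) (h : 'Hom(X, Y)) :
  postcomp X f h = (f \o h)%VF.
Proof.
rewrite /postcomp linfun_linE // => k g g'.
by rewrite comp_lfunDr comp_lfunZr.
Qed.

Lemma lfun_eqP X Y (f g : 'Hom(X, Y)) : f = g -> f =1 g.
Proof. by move->. Qed.

End LinearMaps.

(** * Submodules, quotients, factorisations and lifts in the category of modules *)

Section Modules.
Variables (K : fieldType) (A : falgType K).
Implicit Types M N P Q U V W X Y Z : rmod A.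

Lemma ractDl U a (x y : U) : ract (x + y) a = ract x a + ract y a.
Proof. by rewrite -!ractEE linearD. Qed.

Lemma ractBl U a (x y : U) : ract (x - y) a = ract x a - ract y a.
Proof. by rewrite -!ractEE linearB. Qed.

Lemma ractZl U a k (x : U) : ract (k *: x) a = k *: ract x a.
Proof. by rewrite -!ractEE linearZ. Qed.

Lemma ract0l U a : ract (0 : U) a = 0.
Proof. by rewrite -ractEE linear0. Qed.

Lemma ract_suml U a I (r : seq I) (P : pred I) (F : I -> U) :
  ract (\sum_(i <- r | P i) F i) a = \sum_(i <- r | P i) ract (F i) a.
Proof. by rewrite -ractEE linear_sum; apply: eq_bigr => i _; exact: ractEE. Qed.

Lemma ract_rE U (x : U) : linfun (ract x) =1 ract x.
Proof. exact/linfun_linE/ract_linearr. Qed.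

Lemma ractDr U (x : U) a b : ract x (a + b) = ract x a + ract x b.
Proof. by rewrite -!ract_rE linearD. Qed.

Lemma ractZr U (x : U) k a : ract x (k *: a) = k *: ract x a.
Proof. by rewrite -!ract_rE linearZ. Qed.

Lemma rhom_id U : rhom (\1%VF : 'End(U)).
Proof. by move=> x a; rewrite !id_lfunE. Qed.

Lemma rhom_comp U V W (f : 'Hom(U, V)) (g : 'Hom(V, W)) :
  rhom f -> rhom g -> rhom (g \o f)%VF.
Proof. by move=> fr gr x a; rewrite !comp_lfunE fr gr. Qed.

Lemma rhom0 U V : rhom (0 : 'Hom(U, V)).
Proof. exact/homAP/mem0v. Qed.

Lemma rhomD U V (f g : 'Hom(U, V)) : rhom f -> rhom g -> rhom (f + g).
Proof. by move=> /homAP fr /homAP gr; apply/homAP/memvD. Qed.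

Lemma rhomB U V (f g : 'Hom(U, V)) : rhom f -> rhom g -> rhom (f - g).
Proof. by move=> /homAP fr /homAP gr; apply/homAP/memvB. Qed.

Lemma rhom_sum U V I (r : seq I) (P : pred I) (F : I -> 'Hom(U, V)) :
  (forall i, rhom (F i)) -> rhom (\sum_(i <- r | P i) F i).
Proof. by move=> Fr; apply/homAP/memv_suml => i _; apply/homAP. Qed.

Lemma rhom_inv U V (f : 'Hom(U, V)) :
  rhom f -> is_mono f -> is_epi f -> rhom (f^-1)%VF.
Proof.
move=> fr f0 fE y a; have /epiP/(_ y)[x <-] := fE.
by rewrite -fr !lker0_lfunK ?f0.
Qed.

Lemma riso_refl U : riso U U.
Proof.
exists \1%VF; split; first exact: rhom_id.
  by apply/monoP => x y; rewrite !id_lfunE.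
exact: lim1g.
Qed.

Lemma riso_sym U V : riso U V -> riso V U.
Proof.
move=> [f [fr f0 fE]]; exists (f^-1)%VF; split; first exact: rhom_inv.
  apply/monoP => x y; have /epiP fP := fE.
  by have [[u <-] [v <-]] := (fP x, fP y); rewrite !lker0_lfunK ?f0 // => ->.
by apply/epiP => x; exists (f x); rewrite lker0_lfunK ?f0.
Qed.

Lemma rhom_ker U V (f : 'Hom(U, V)) : rhom f -> submodule (lker f).
Proof. by move=> fr x a; rewrite !memv_ker fr => /eqP->; rewrite ract0l. Qed.

Lemma rhom_img U V (f : 'Hom(U, V)) (W : {vspace U}) :
  rhom f -> submodule W -> submodule (f @: W).
Proof. by move=> fr sW _ a /memv_imgP[x xW ->]; rewrite -fr memv_img ?sW. Qed.

Lemma submoduleT U : submodule {:U}.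
Proof. by move=> x a _; rewrite memvf. Qed.

Lemma submodule0 U : submodule (0 : {vspace U})%VS.
Proof. by move=> x a; rewrite !memv0 => /eqP->; rewrite ract0l. Qed.

Lemma rhom_limg U V (f : 'Hom(U, V)) : rhom f -> submodule (limg f).
Proof. by move=> fr; apply: rhom_img => //; apply: submoduleT. Qed.

Lemma rhom_preim U V (f : 'Hom(U, V)) (W : {vspace V}) :
  rhom f -> submodule W -> submodule (f @^-1: W)%VS.
Proof. by move=> fr sW x a; rewrite -!memv_preim fr => /sW. Qed.

Lemma submodule_cap U (W W' : {vspace U}) :
  submodule W -> submodule W' -> submodule (W :&: W')%VS.
Proof. by move=> sW sW' x a; rewrite !memv_cap => /andP[/sW-> /sW'->]. Qed.

Lemma submodule_add U (W W' : {vspace U}) :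
  submodule W -> submodule W' -> submodule (W + W')%VS.
Proof.
by move=> sW sW' x a /memv_addP[u uW [v vW ->]]; rewrite ractDl memv_add ?sW ?sW'.
Qed.

Section Submod.
Variables (U : rmod A) (W : {vspace U}) (sW : submodule W).

Let act (x : subvs_of W) (a : A) : subvs_of W := Subvs (sW a (subvsP x)).

Fact submod_linearl a : linear (act ^~ a).
Proof. by move=> k x y; apply/val_inj; rewrite /= ractDl ractZl. Qed.
Fact submod_linearr x : linear (act x).
Proof. by move=> k a b; apply/val_inj; rewrite /= ractDr ractZr. Qed.
Fact submod_act1 x : act x 1 = x.
Proof. by apply/val_inj; rewrite /= ract1. Qed.
Fact submod_actM x a b : act x (a * b) = act (act x a) b.
Proof. by apply/val_inj; rewrite /= ractM. Qed.

Definition submod : rmod A :=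
  RMod submod_linearl submod_linearr submod_act1 submod_actM.

Definition submod_incl : 'Hom(submod, U) := linfun vsval.

Lemma submod_inclE x : submod_incl x = vsval x.
Proof. exact: lfunE. Qed.

Lemma submod_incl_rhom : rhom submod_incl.
Proof. by move=> x a; rewrite !submod_inclE. Qed.

Lemma submod_incl_mono : is_mono submod_incl.
Proof. by apply/monoP => x y; rewrite !submod_inclE => /val_inj. Qed.

Lemma submod_incl_img : limg submod_incl = W.
Proof.
apply/vspaceP => x; apply/memv_imgP/idP => [[y _ ->]|xW].
  by rewrite submod_inclE subvsP.
by exists (vsproj W x); rewrite ?memvf // submod_inclE vsprojK.
Qed.

Lemma submod_inclP x : submod_incl x \in W.
Proof. by rewrite submod_inclE subvsP. Qed.

Lemma submod_incl_eq0 x : (submod_incl x == 0) = (x == 0).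
Proof. by rewrite -memv_ker -memv0 (submod_incl_mono : lker _ = _). Qed.

Lemma submod_dim : \dim {:submod} = \dim W.
Proof. by rewrite dimvf. Qed.

Lemma corestrict X (h : 'Hom(X, U)) : rhom h -> (limg h <= W)%VS ->
  exists2 h' : 'Hom(X, submod), rhom h' & (submod_incl \o h' = h)%VF.
Proof.
move=> hr /subvP hW; pose h' : 'Hom(X, submod) := (linfun (vsproj W) \o h)%VF.
have h'E x : submod_incl (h' x) = h x.
  by rewrite submod_inclE comp_lfunE lfunE vsprojK ?hW ?memv_img ?memvf.
exists h'; last by apply/lfunP => x; rewrite comp_lfunE h'E.
move=> x a; have /monoP := submod_incl_mono; apply.
by rewrite submod_incl_rhom !h'E hr.
Qed.

End Submod.

(** The action is transported along [p] through the linear section [p^-1]; since W is a submodule,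
    the choice of preimage does not matter. *)
Lemma quotient_exists U (W : {vspace U}) : submodule W ->
  exists (Q : rmod A) (p : 'Hom(U, Q)), [/\ rhom p, is_epi p & lker p = W].
Proof.
move=> sW; have [C [p [pE pk]]] := linear_quotient_exists W.
have p0 x : (p x == 0) = (x \in W) by rewrite -memv_ker pk.
have pS y : p (p^-1%VF y) = y by rewrite limg_lfunVK // (pE : limg p = _) memvf.
pose act (y : C) (a : A) : C := p (ract (p^-1%VF y) a).
have actE x a : act (p x) a = p (ract x a).
  apply/eqP; rewrite -subr_eq0 -linearB -ractBl p0 sW //.
  by rewrite -p0 linearB /= pS subrr.
have pW (y : C) : exists x, y = p x by exists (p^-1%VF y).
have lin_l a : linear (act ^~ a).
  move=> k y z; have [[u ->] [v ->]] := (pW y, pW z).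
  by rewrite -linearP !actE ractDl ractZl linearP.
have lin_r y : linear (act y).
  move=> k a b; have [u ->] := pW y.
  by rewrite !actE ractDr ractZr linearP.
have act1 y : act y 1 = y by have [u ->] := pW y; rewrite actE ract1.
have actM y a b : act y (a * b) = act (act y a) b.
  by have [u ->] := pW y; rewrite !actE ractM.
by exists (RMod lin_l lin_r act1 actM), p; split=> [x a||] //; rewrite /= actE.
Qed.

(** The section [p^-1] is merely linear, but the inclusion of kernels makes [h \o p^-1] independent
    of it, hence A-linear. *)
Lemma factor_epi U V X (p : 'Hom(U, V)) (h : 'Hom(U, X)) :
  rhom p -> is_epi p -> rhom h -> (lker p <= lker h)%VS ->
  exists2 h' : 'Hom(V, X), rhom h' & (h' \o p = h)%VF.
Proof.
move=> pr pE hr /subvP kk; pose h' : 'Hom(V, X) := (h \o p^-1)%VF.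
have pS y : p (p^-1%VF y) = y.
  by have /epiP/(_ y)[x <-] := pE; rewrite limg_lfunVK // memv_img ?memvf.
have h'E x : h' (p x) = h x.
  rewrite comp_lfunE; apply/eqP; rewrite -subr_eq0 -linearB -memv_ker; apply: kk.
  by rewrite memv_ker linearB /= pS subrr.
exists h'; last by apply/lfunP => x; rewrite comp_lfunE h'E.
by move=> y a; have /epiP/(_ y)[x <-] := pE; rewrite -pr !h'E hr.
Qed.

Lemma retract_projective P Q (i : 'Hom(Q, P)) (p : 'Hom(P, Q)) :
  rhom i -> rhom p -> (p \o i = \1)%VF -> projective P -> projective Q.
Proof.
move=> ir pr pi1 Pp X Y g h gr gE hr.
have [h' h'r h'E] := Pp X Y g (h \o p)%VF gr gE (rhom_comp pr hr).
exists (h' \o i)%VF; first exact: rhom_comp.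
by rewrite comp_lfunA h'E -comp_lfunA pi1 comp_lfun1r.
Qed.

(** Corestricting [g] and [h] to the image of [g] reduces this to lifting along an epimorphism. *)
Lemma projective_lift P X Y (g : 'Hom(X, Y)) (h : 'Hom(P, Y)) :
  projective P -> rhom g -> rhom h -> (limg h <= limg g)%VS ->
  exists2 h' : 'Hom(P, X), rhom h' & (g \o h' = h)%VF.
Proof.
move=> Pp gr hr hg; have sI := rhom_limg gr.
have [g1 g1r g1E] := corestrict sI gr (subvv _).
have [h1 h1r h1E] := corestrict sI hr hg.
have g1epi : is_epi g1.
  apply/epiP => y; have /memv_imgP[x _ xE] := submod_inclP y.
  exists x; have /monoP := submod_incl_mono sI; apply.
  by rewrite xE -[in RHS]g1E comp_lfunE.
have [h' h'r h'E] := Pp _ _ g1 h1 g1r g1epi h1r.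
by exists h' => //; rewrite -g1E -comp_lfunA h'E h1E.
Qed.

End Modules.

Arguments submod_incl_rhom {K A U W} sW x a : rename.

(** * Direct sums and powers, the class Fac M and the trace of M in a module *)

Section Sums.
Variables (K : fieldType) (A : falgType K).
Implicit Types M N P Q U V W X Y Z : rmod A.

Section DsumMaps.
Variables U V : rmod A.

Definition dfst : 'Hom(dsum U V, U) := linfun (fun x : dsum U V => x.1).
Definition dsnd : 'Hom(dsum U V, V) := linfun (fun x : dsum U V => x.2).
Definition dinl : 'Hom(U, dsum U V) := linfun (fun x : U => (x, 0) : dsum U V).
Definition dinr : 'Hom(V, dsum U V) := linfun (fun x : V => (0, x) : dsum U V).

Lemma dfstE x : dfst x = x.1. Proof. exact: linfun_linE. Qed.
Lemma dsndE x : dsnd x = x.2. Proof. exact: linfun_linE. Qed.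
Lemma dinlE x : dinl x = (x, 0).
Proof. by apply: linfun_linE => k y z; congr pair; rewrite /= scaler0 addr0. Qed.
Lemma dinrE x : dinr x = (0, x).
Proof. by apply: linfun_linE => k y z; congr pair; rewrite /= scaler0 addr0. Qed.

Lemma dfst_rhom : rhom dfst. Proof. by move=> x a; rewrite !dfstE. Qed.
Lemma dsnd_rhom : rhom dsnd. Proof. by move=> x a; rewrite !dsndE. Qed.
Lemma dinl_rhom : rhom dinl.
Proof. by move=> x a; rewrite !dinlE; congr pair; rewrite /= ract0l. Qed.
Lemma dinr_rhom : rhom dinr.
Proof. by move=> x a; rewrite !dinrE; congr pair; rewrite /= ract0l. Qed.

Lemma dfst_inl : (dfst \o dinl = \1)%VF.
Proof. by apply/lfunP => x; rewrite comp_lfunE dinlE dfstE id_lfunE. Qed.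
Lemma dsum_id : ((dinl \o dfst) + (dinr \o dsnd) = \1)%VF.
Proof.
apply/lfunP => x; rewrite add_lfunE !comp_lfunE id_lfunE dfstE dsndE dinlE dinrE.
by case: x => x y; congr pair; rewrite /= ?addr0 ?add0r.
Qed.

Lemma dsum_split x : x = dinl x.1 + dinr x.2 :> dsum U V.
Proof. by rewrite -dfstE -dsndE -!comp_lfunE -add_lfunE dsum_id id_lfunE. Qed.

End DsumMaps.

Definition copair U V X (f : 'Hom(U, X)) (g : 'Hom(V, X)) : 'Hom(dsum U V, X) :=
  ((f \o dfst U V) + (g \o dsnd U V))%VF.

Lemma copairE U V X (f : 'Hom(U, X)) (g : 'Hom(V, X)) x :
  copair f g x = f x.1 + g x.2.
Proof. by rewrite add_lfunE !comp_lfunE dfstE dsndE. Qed.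

Lemma copair_rhom U V X (f : 'Hom(U, X)) (g : 'Hom(V, X)) :
  rhom f -> rhom g -> rhom (copair f g).
Proof.
move=> fr gr; apply: rhomD; apply: rhom_comp => //.
  exact: dfst_rhom.
exact: dsnd_rhom.
Qed.

Definition dsum_map U V X Y (f : 'Hom(U, X)) (g : 'Hom(V, Y)) :
    'Hom(dsum U V, dsum X Y) :=
  copair (dinl X Y \o f)%VF (dinr X Y \o g)%VF.

Lemma dsum_mapE U V X Y (f : 'Hom(U, X)) (g : 'Hom(V, Y)) x :
  dsum_map f g x = (f x.1, g x.2).
Proof.
rewrite copairE !comp_lfunE dinlE dinrE.
by congr pair; rewrite /= ?addr0 ?add0r.
Qed.

Lemma dsum_map_rhom U V X Y (f : 'Hom(U, X)) (g : 'Hom(V, Y)) :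
  rhom f -> rhom g -> rhom (dsum_map f g).
Proof.
move=> fr gr; apply: copair_rhom; apply: rhom_comp => //.
  exact: dinl_rhom.
exact: dinr_rhom.
Qed.

Lemma dsum_projective P Q : projective P -> projective Q -> projective (dsum P Q).
Proof.
move=> Pp Qp X Y g h gr gE hr.
have [k kr kE] := Pp _ _ g _ gr gE (rhom_comp (@dinl_rhom P Q) hr).
have [l lr lE] := Qp _ _ g _ gr gE (rhom_comp (@dinr_rhom P Q) hr).
exists (copair k l); first exact: copair_rhom.
rewrite comp_lfunDr !comp_lfunA kE lE -!comp_lfunA -comp_lfunDr dsum_id.
by rewrite comp_lfun1r.
Qed.

Section PowerMaps.
Variables (U : rmod A) (k : nat).

Definition pproj (i : 'I_k) : 'Hom(power_mod U k, U) :=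
  linfun (fun x : power_mod U k => (x : {ffun 'I_k -> U}) i).
Definition pinj (i : 'I_k) : 'Hom(U, power_mod U k) :=
  linfun (fun x : U => [ffun j => if j == i then x else 0] : power_mod U k).

Lemma pprojE i x : pproj i x = (x : {ffun 'I_k -> U}) i.
Proof. by apply: linfun_linE => c y z; rewrite !ffunE. Qed.
Lemma pinjE i x : pinj i x = [ffun j => if j == i then x else 0].
Proof.
apply: linfun_linE => c y z; apply/ffunP => j; rewrite !ffunE.
by case: eqP => // _; rewrite scaler0 addr0.
Qed.

Lemma pproj_rhom i : rhom (pproj i).
Proof. by move=> x a; rewrite !pprojE ffunE. Qed.
Lemma pinj_rhom i : rhom (pinj i).
Proof.
move=> x a; apply/ffunP => j; rewrite !pinjE !ffunE.
by case: eqP => // _; rewrite ract0l.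
Qed.

Lemma power_split (x : power_mod U k) : x = \sum_i pinj i (pproj i x).
Proof.
apply/ffunP => j; rewrite sum_ffunE (bigD1 j) //= pinjE ffunE eqxx pprojE.
rewrite big1 ?addr0 // => i ij; rewrite pinjE ffunE.
by case: eqP => // ji; rewrite ji eqxx in ij.
Qed.

Lemma power_id : (\sum_i (pinj i \o pproj i) = \1)%VF.
Proof.
apply/lfunP => x; rewrite sum_lfunE id_lfunE [RHS]power_split.
by apply: eq_bigr => i _; rewrite comp_lfunE.
Qed.

Lemma pproj_inj i x : pproj i (pinj i x) = x.
Proof. by rewrite pprojE pinjE ffunE eqxx. Qed.

Definition pcopair X (f : 'I_k -> 'Hom(U, X)) : 'Hom(power_mod U k, X) :=
  (\sum_i (f i \o pproj i))%VF.

Lemma pcopairE X (f : 'I_k -> 'Hom(U, X)) x :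
  pcopair f x = \sum_i f i ((x : {ffun 'I_k -> U}) i).
Proof.
by rewrite sum_lfunE; apply: eq_bigr => i _; rewrite comp_lfunE pprojE.
Qed.

Lemma pcopair_rhom X (f : 'I_k -> 'Hom(U, X)) :
  (forall i, rhom (f i)) -> rhom (pcopair f).
Proof. by move=> fr; apply: rhom_sum => i; apply/rhom_comp/fr/pproj_rhom. Qed.

Lemma power_projective : projective U -> projective (power_mod U k).
Proof.
move=> Up X Y g h gr gE hr.
have lift i : exists l : 'Hom(U, X), rhom l /\ (g \o l = h \o pinj i)%VF.
  have [l lr lE] := Up _ _ g _ gr gE (rhom_comp (pinj_rhom i) hr).
  by exists l.
have [l lP] := choice lift; exists (pcopair l).
  by apply: pcopair_rhom => i; have [] := lP i.
rewrite -[h]comp_lfun1r -power_id; apply/lfunP => x.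
rewrite comp_lfunE pcopairE linear_sum comp_lfunE sum_lfunE linear_sum.
apply: eq_bigr => i _; have [_ /lfun_eqP/(_ (pproj i x))] := lP i.
by rewrite !comp_lfunE pprojE.
Qed.

End PowerMaps.

Lemma summand_refl U : summand U U.
Proof.
exists (submod (@submodule0 _ _ U)); exists (dinl _ _); split.
- exact: dinl_rhom.
- by apply/monoP => x y; rewrite !dinlE => -[].
apply/epiP => -[x y]; exists x; rewrite dinlE; congr pair.
by apply/val_inj/esym/eqP; rewrite -memv0 subvsP.
Qed.

Lemma summandP Y X : summand Y X ->
  exists (i : 'Hom(Y, X)) (p : 'Hom(X, Y)),
    [/\ rhom i, rhom p & (p \o i = \1)%VF].
Proof.
move=> [Z [f [fr f0 fE]]].
exists (f^-1 \o dinl Y Z)%VF, (dfst Y Z \o f)%VF; split.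
- exact/rhom_comp/rhom_inv/fE/f0/fr/dinl_rhom.
- exact/rhom_comp/dfst_rhom.
rewrite comp_lfunA -(comp_lfunA _ f).
have -> : (f \o f^-1 = \1)%VF.
  apply/lfunP => x; rewrite comp_lfunE id_lfunE.
  by rewrite limg_lfunVK // (fE : limg f = _) memvf.
by rewrite comp_lfun1r dfst_inl.
Qed.

Lemma Fac_power M X : Fac M X <->
  exists k (e : 'Hom(power_mod M k, X)), rhom e /\ is_epi e.
Proof.
split=> [[N [f [[k /summandP[i [p [ir pr pi]]]] fr fE]]]|[k [e [er eE]]]].
  exists k, (f \o p)%VF; split; first exact: rhom_comp.
  apply: comp_epi => //; apply/epiP => y; exists (i y).
  by rewrite -comp_lfunE pi id_lfunE.
by exists (power_mod M k), e; split=> //; exists k; apply: summand_refl.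
Qed.

Lemma Fac_refl M : Fac M M.
Proof.
apply/Fac_power; exists 1%N, (pproj M ord0); split; first exact: pproj_rhom.
by apply/epiP => y; exists (pinj M ord0 y); rewrite pproj_inj.
Qed.

Lemma Fac_quot M X Y (f : 'Hom(X, Y)) : rhom f -> is_epi f -> Fac M X -> Fac M Y.
Proof.
move=> fr fE /Fac_power[k [e [er eE]]]; apply/Fac_power.
by exists k, (f \o e)%VF; split; [apply: rhom_comp | apply: comp_epi].
Qed.

(** The sum runs over a basis of Hom(M, X) to stay finite; by linearity it contains the image of
    every homomorphism ([limg_trace]). *)
Definition trace M X : {vspace X} :=
  (\sum_(i < \dim (homA M X)) limg (vbasis (homA M X))`_i)%VS.

Lemma limg_trace M X (h : 'Hom(M, X)) : rhom h -> (limg h <= trace M X)%VS.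
Proof.
move=> /homAP/coord_vbasis->; apply/subvP => _ /memv_imgP[x _ ->].
rewrite sum_lfunE; apply: memv_suml => i _; rewrite scale_lfunE memvZ //.
by apply: (subvP (sumv_sup i isT (subvv _))); rewrite memv_img ?memvf.
Qed.

Lemma memv_trace M X (h : 'Hom(M, X)) y : rhom h -> h y \in trace M X.
Proof. by move=> /limg_trace/subvP; apply; rewrite memv_img ?memvf. Qed.

Lemma vbasis_rhom M X i : rhom (vbasis (homA M X))`_i.
Proof.
have [ltid|leid] := ltnP i (\dim (homA M X)); last first.
  by rewrite nth_default ?size_tuple //; apply: rhom0.
by apply/homAP/vbasis_mem/mem_nth; rewrite size_tuple.
Qed.

Lemma trace_submodule M X : submodule (trace M X).
Proof.
move=> x a /memv_sumP[w wP ->]; rewrite ract_suml; apply: memv_sumr => i _.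
by apply: rhom_limg; [apply: vbasis_rhom | apply: wP].
Qed.

Lemma traceP M X x : x \in trace M X -> exists k (h : 'I_k -> 'Hom(M, X)) w,
  (forall i, rhom (h i)) /\ x = \sum_i h i (w i).
Proof.
move=> /memv_sumP[w wP ->]; exists (\dim (homA M X)).
exists (fun i => (vbasis (homA M X))`_i).
exists (fun i : 'I__ => ((vbasis (homA M X))`_i)^-1%VF (w i)).
split=> [i|]; first exact: vbasis_rhom.
by apply: eq_bigr => i _; rewrite limg_lfunVK ?wP.
Qed.

Lemma Fac_trace M X : Fac M X <-> trace M X = fullv.
Proof.
split=> [/Fac_power[k [e [er eE]]]|trE].
  apply/eqP; rewrite eqEsubv subvf /= -[X in (X <= _)%VS](eE : limg e = _).
  apply/subvP => _ /memv_imgP[x _ ->]; rewrite (power_split x) linear_sum.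
  apply: memv_suml => i _; rewrite /= -(comp_lfunE e).
  exact/memv_trace/rhom_comp/er/pinj_rhom.
apply/Fac_power; exists (\dim (homA M X)).
exists (pcopair (fun i => (vbasis (homA M X))`_i)); split.
  by apply: pcopair_rhom => i; apply: vbasis_rhom.
apply/epiP => x; have: x \in trace M X by rewrite trE memvf.
move=> /memv_sumP[w wP ->].
exists [ffun i : 'I_(\dim (homA M X)) => ((vbasis (homA M X))`_i)^-1%VF (w i)].
by rewrite pcopairE; apply: eq_bigr => i _; rewrite ffunE limg_lfunVK ?wP.
Qed.

(** Every map M -> X lands in the trace, so the maps whose images sum to the trace corestrict to
    maps into it. *)
Lemma Fac_submod_trace M X (sT : submodule (trace M X)) : Fac M (submod sT).
Proof.
apply/Fac_trace/eqP; rewrite eqEsubv subvf /=; apply/subvP => x _.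
have xT : submod_incl sT x \in trace M X.
  exact: submod_inclP.
have [k [h [w [hr xE]]]] := traceP xT.
have cor i := corestrict sT (hr i) (limg_trace (hr i)).
have -> : x = \sum_i (s2val (cid2 (cor i))) (w i).
  have /monoP := submod_incl_mono sT; apply.
  rewrite xE linear_sum; apply: eq_bigr => i _.
  by case: cid2 => h' /= _ /lfun_eqP/(_ (w i)) <-; rewrite comp_lfunE.
by apply: memv_suml => i _; case: cid2 => h' /= h'r _; apply: (memv_trace (w i) h'r).
Qed.

Lemma Fac_hom_zero M X : Fac M X -> hom_zero M X -> zeromod X.
Proof.
move=> /Fac_trace trE h0; apply/eqP; rewrite dimv_eq0 -trE -subv0.
apply/subv_sumP => i _; rewrite (h0 _ (@vbasis_rhom M X i)).
by apply/subvP => _ /memv_imgP[x _ ->]; rewrite zero_lfunE mem0v.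
Qed.

Lemma zeromodP X : zeromod X <-> forall x : X, x = 0.
Proof.
split=> [/eqP | X0].
  by rewrite dimv_eq0 => /eqP E x; apply/eqP; rewrite -memv0 -E memvf.
by apply/eqP; rewrite dimv_eq0 -subv0; apply/subvP => x _; rewrite (X0 x) mem0v.
Qed.

Lemma hom_zero_dim M X : hom_zero M X <-> \dim (homA M X) = 0%N.
Proof.
split=> [h0|/eqP].
  apply/eqP; rewrite dimv_eq0 -subv0; apply/subvP => f /homAP/h0->.
  exact: mem0v.
by rewrite dimv_eq0 => /eqP E f /homAP; rewrite E memv0 => /eqP.
Qed.

Lemma regmod_projective : projective (regmod A).
Proof.
move=> X Y g h gr gE hr; have /epiP/(_ (h 1))[x xE] := gE.
pose l : 'Hom(regmod A, X) := linfun (ract x).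
have lE a : l a = ract x a by apply/linfun_linE/ract_linearr.
exists l => [a b|]; first by rewrite !lE /= ractM.
by apply/lfunP => a; rewrite comp_lfunE lE gr xE -hr /= mul1r.
Qed.

Lemma Fac_regmod X : Fac (regmod A) X.
Proof.
apply/Fac_trace/eqP; rewrite eqEsubv subvf /=; apply/subvP => x _.
pose l : 'Hom(regmod A, X) := linfun (ract x).
have lE a : l a = ract x a by apply/linfun_linE/ract_linearr.
have lr : rhom l by move=> a b; rewrite !lE /= ractM.
by rewrite -[x]ract1 -lE memv_trace.
Qed.

End Sums.

(** * Projective presentations and the dimensions of Hom spaces *)

Section Presentations.
Variables (K : fieldType) (A : falgType K).
Implicit Types M N P Q U V W X Y Z : rmod A.

Definition presentation P1 P0 M (f : 'Hom(P1, P0)) (g : 'Hom(P0, M)) : Prop :=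
  [/\ projective P1 /\ projective P0, rhom f, rhom g, is_epi g & limg f = lker g].

(* For a minimal presentation f this says Hom(X, tau M) = 0. *)
Definition extendable P1 P0 (f : 'Hom(P1, P0)) X : Prop :=
  forall k : 'Hom(P1, X), rhom k ->
    exists2 l : 'Hom(P0, X), rhom l & (l \o f = k)%VF.

(** As [P1] is projective, a map to X lifts along an epimorphism from a power of M. The components
    of the lift extend along [f], and the extensions are reassembled and pushed down to X. *)
Lemma extendable_Fac P1 P0 M X (f : 'Hom(P1, P0)) :
  projective P1 -> extendable f M -> Fac M X -> extendable f X.
Proof.
move=> Pp fM /Fac_power[m [e [er eE]]] k kr.
have [k' k'r k'E] := Pp _ _ e k er eE kr.
have ext i : exists l : 'Hom(P0, M), rhom l /\ (l \o f = pproj M i \o k')%VF.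
  have [l lr lE] := fM _ (rhom_comp k'r (@pproj_rhom _ _ M m i)).
  by exists l.
have [l lP] := choice ext.
exists (e \o \sum_i (pinj M i \o l i))%VF.
  apply: rhom_comp => //; apply: rhom_sum => i.
  by apply: rhom_comp; [have [] := lP i | apply: pinj_rhom].
rewrite -k'E -comp_lfunA; congr (_ \o _)%VF; apply/lfunP => x.
rewrite comp_lfunE sum_lfunE [RHS]power_split; apply: eq_bigr => i _.
have [_ /lfun_eqP/(_ x)] := lP i.
by rewrite !comp_lfunE => ->.
Qed.

Section HomDimension.
Variables (P1 P0 M : rmod A) (f : 'Hom(P1, P0)) (g : 'Hom(P0, M)).
Hypothesis fgP : presentation f g.

(** Left exactness of Hom(-, X): the maps killed by precomposition with [f] are those factoring
    through [g], and precomposition with the epimorphism [g] is injective. *)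
Lemma hom_ker_precomp X :
  \dim (homA P0 X :&: lker (precomp X f))%VS = \dim (homA M X).
Proof.
have [_ fr gr gE fg] := fgP.
suff -> : (homA P0 X :&: lker (precomp X f))%VS = (precomp X g @: homA M X)%VS.
  apply: limg_dim_eq; apply/eqP; rewrite -subv0; apply/subvP => h.
  rewrite memv_cap memv_ker precompE => /andP[_ /eqP hg].
  rewrite memv0; apply/eqP/lfunP => y; have /epiP/(_ y)[x <-] := gE.
  by rewrite -comp_lfunE hg !zero_lfunE.
apply/vspaceP => h; rewrite memv_cap memv_ker precompE.
apply/andP/memv_imgP => [[/homAP hr /eqP hf]|[k /homAP kr ->]]; last first.
  rewrite precompE; split; first exact/homAP/rhom_comp.
  apply/eqP/lfunP => x; rewrite !comp_lfunE zero_lfunE.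
  have : f x \in lker g by rewrite -fg memv_img ?memvf.
  by rewrite memv_ker => /eqP->; rewrite linear0.
have [|k kr kE] := factor_epi gr gE hr; last first.
  by exists k; [apply/homAP | rewrite precompE].
rewrite -fg; apply/subvP => _ /memv_imgP[x _ ->].
by rewrite memv_ker -comp_lfunE hf zero_lfunE.
Qed.

Lemma hom_img_precomp X : (precomp X f @: homA P0 X <= homA P1 X)%VS.
Proof.
have [_ fr _ _ _] := fgP; apply/subvP => _ /memv_imgP[h /homAP hr ->].
by rewrite precompE; apply/homAP/rhom_comp.
Qed.

(** Rank-nullity for precomposition with [f], whose image lies in Hom(P1, X). Extendability says
    that this image is everything, which turns the bound into the equality of
    [hom_dim_extendable]. *)
Lemma hom_dim_le X :
  (\dim (homA P0 X) <= \dim (homA M X) + \dim (homA P1 X))%N.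
Proof.
rewrite -hom_ker_precomp -(limg_ker_dim (precomp X f)) leq_add2l.
exact/dimvS/hom_img_precomp.
Qed.

Lemma hom_dim_extendable X : extendable f X ->
  \dim (homA P0 X) = (\dim (homA M X) + \dim (homA P1 X))%N.
Proof.
move=> fX; rewrite -hom_ker_precomp -(limg_ker_dim (precomp X f)).
congr (_ + \dim _)%N; apply/eqP; rewrite eqEsubv hom_img_precomp /=.
apply/subvP => k /homAP/fX[l lr <-]; rewrite -precompE.
by apply: memv_img; apply/homAP.
Qed.

(** Given h : M -> Q, lift [h \o g] to l : P0 -> U. Then [l \o f] lands in the trace, which is in
    Fac M, so it extends to some l' from P0 into the trace. The difference l - l' kills the image of
    [f], hence factors through M and also lands in the trace. So l does, and [h \o g = p \o l]
    vanishes. *)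
Lemma trace_quotient_hom_zero U Q (p : 'Hom(U, Q)) :
  extendable f M -> rhom p -> is_epi p -> lker p = trace M U -> hom_zero M Q.
Proof.
have [[P1p P0p] fr gr gE fg] := fgP.
move=> fM pr pE kp h hr.
have [l lr lE] := P0p _ _ p (h \o g)%VF pr pE (rhom_comp gr hr).
have gf x : g (f x) = 0.
  by apply/eqP; rewrite -memv_ker -fg memv_img ?memvf.
have lfT : (limg (l \o f) <= trace M U)%VS.
  apply/subvP => _ /memv_imgP[x _ ->]; rewrite -kp memv_ker.
  by rewrite comp_lfunE -(comp_lfunE p) lE comp_lfunE gf linear0.
have sT := @trace_submodule _ _ M U.
have [k kr kE] := corestrict sT (rhom_comp fr lr) lfT.
have [l' l'r l'E] := extendable_Fac P1p fM (Fac_submod_trace sT) kr.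
pose d : 'Hom(P0, U) := l - (submod_incl sT \o l')%VF.
have dr : rhom d by apply/rhomB/rhom_comp/submod_incl_rhom.
have [|s sr sE] := factor_epi gr gE dr.
  rewrite -fg; apply/subvP => _ /memv_imgP[x _ ->].
  rewrite memv_ker add_lfunE opp_lfunE -!(comp_lfunE _ f) -kE -l'E.
  by rewrite comp_lfunA subrr.
apply/lfunP => y; have /epiP/(_ y)[x <-] := gE.
have dx : d x \in trace M U by rewrite -sE comp_lfunE memv_trace.
have lx : l x \in trace M U.
  rewrite -[l x](subrK (submod_incl sT (l' x))) memvD ?submod_inclP //.
  by move: dx; rewrite add_lfunE opp_lfunE comp_lfunE.
by move: lx; rewrite -kp memv_ker zero_lfunE -comp_lfunE lE comp_lfunE => /eqP.
Qed.

End HomDimension.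
End Presentations.

(** * Composition series and dimension vectors *)

Section DimensionVectors.
Variables (K : fieldType) (A : falgType K) (n : nat) (S : 'I_n -> rmod A).
Implicit Types M N P Q U V X Y Z : rmod A.

(** Hom(P, W) cut out inside the maps P -> X, so that all steps of a filtration of X share one
    ambient space; [\1 - projv W] has kernel W. *)
Definition hom_into P X (W : {vspace X}) : {vspace 'Hom(P, X)} :=
  (homA P X :&: lker (postcomp P (\1%VF - projv W)%R))%VS.

Lemma hom_intoP P X (W : {vspace X}) (h : 'Hom(P, X)) :
  reflect (rhom h /\ limg h <= W)%VS (h \in hom_into P W).
Proof.
rewrite memv_cap memv_ker postcompE.
apply: (iffP andP) => [[/homAP hr /eqP h0]|[hr hW]]; split=> //.
- apply/subvP => _ /memv_imgP[x _ ->]; move/lfun_eqP/(_ x): h0.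
  rewrite comp_lfunE add_lfunE opp_lfunE id_lfunE zero_lfunE.
  by move=> /subr0_eq->; apply: memv_proj.
- exact/homAP.
apply/eqP/lfunP => x; rewrite comp_lfunE add_lfunE opp_lfunE id_lfunE zero_lfunE.
by rewrite projv_id ?subrr // (subvP hW) // memv_img ?memvf.
Qed.

(** Exactness of Hom(P, -): postcomposition with [f] has kernel Hom(P, W), and projectivity makes it
    onto Hom(P, T). Since [f] is A-linear only on W', the lift is taken along its restriction to
    W'. *)
Lemma hom_into_subquotient P X T (W W' : {vspace X}) :
  projective P -> submodule W' -> subquotient_iso W W' T ->
  \dim (hom_into P W') = (\dim (hom_into P W) + \dim (homA P T))%N.
Proof.
move=> Pp sW' [f [fr fW' fW]]; rewrite -(limg_ker_dim (postcomp P f) (hom_into P W')).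
congr (_ + _)%N; congr dimv; apply/vspaceP => h.
  rewrite memv_cap memv_ker postcompE.
  apply/andP/hom_intoP => [[/hom_intoP[hr hW'] /eqP fh]|[hr hW]].
    split=> //; rewrite -fW subv_cap hW' /=.
    apply/subvP => _ /memv_imgP[x _ ->].
    by rewrite memv_ker -comp_lfunE fh zero_lfunE.
  move: hW; rewrite -fW subv_cap => /andP[hW' /subvP hk]; split.
    exact/hom_intoP.
  apply/eqP/lfunP => x; rewrite comp_lfunE zero_lfunE; apply/eqP.
  by rewrite -memv_ker hk // memv_img ?memvf.
apply/memv_imgP/homAP => [[k /hom_intoP[kr /subvP kW'] ->] x a|hr].
  by rewrite postcompE !comp_lfunE kr fr // kW' // memv_img ?memvf.
have f'r : rhom (f \o submod_incl sW')%VF.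
  by move=> x a; rewrite !comp_lfunE submod_incl_rhom fr // submod_inclP.
have f'E : is_epi (f \o submod_incl sW')%VF.
  by rewrite /is_epi limg_comp submod_incl_img.
have [k kr kE] := Pp _ _ _ h f'r f'E hr.
exists (submod_incl sW' \o k)%VF; last by rewrite postcompE comp_lfunA.
apply/hom_intoP; split; first exact/rhom_comp/submod_incl_rhom.
by rewrite -[X in (_ <= X)%VS](submod_incl_img sW') limg_comp limgS ?subvf.
Qed.

(** Hom(P, -) is additive along the composition series; the factors are then grouped by isomorphism
    class. *)
Lemma hom_dimvec P X d : projective P -> has_dimvec S X d ->
  \dim (homA P X) = (\sum_i d i * \dim (homA P (S i)))%N.
Proof.
move=> Pp [l [F [s [F0 Fl Fsub Fq dE]]]].
pose c i := \dim (homA P (S i)).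
have dimF k : (k <= l)%N ->
    \dim (hom_into P (F k)) = (\sum_(j < l | j < k) c (s j))%N.
  elim: k => [_|k IHk lt_kl].
    rewrite big_pred0 // F0; apply/eqP; rewrite dimv_eq0 -subv0.
    apply/subvP => h /hom_intoP[_ /subvP h0]; rewrite memv0; apply/eqP/lfunP => x.
    by apply/eqP; rewrite zero_lfunE -memv0 h0 // memv_img ?memvf.
  rewrite (hom_into_subquotient Pp (Fsub _ lt_kl) (Fq (Ordinal lt_kl))) /=.
  rewrite IHk 1?ltnW // [in RHS](bigD1 (Ordinal lt_kl)) /= ?ltnSn // addnC.
  congr (_ + _)%N; apply: eq_bigl => j.
  by rewrite ltnS -val_eqE /= [in RHS]leq_eqVlt; case: ltngtP.
have -> : homA P X = hom_into P (F l).
  by apply/vspaceP => h; apply/homAP/hom_intoP => [|[]//]; rewrite Fl subvf.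
rewrite dimF // (partition_big s xpredT) //=.
apply: eq_bigr => i _; rewrite dE -sum1_card big_distrl /=.
by apply: eq_big => [k|k /andP[_ /eqP->]]; rewrite ?inE ?ltn_ord ?mul1n.
Qed.

Lemma dimvec_eq0 X d : has_dimvec S X d -> (forall i, d i = 0%N) -> zeromod X.
Proof.
move=> [[|l] [F [s [F0 Fl Fsub Fq dE]]]] d0.
  by rewrite /zeromod -[LHS](congr1 _ Fl) F0 dimv0.
have := d0 (s ord0); rewrite dE => /eqP.
by rewrite cards_eq0 => /eqP/setP/(_ ord0); rewrite !inE eqxx.
Qed.

Hypothesis S_reps : simple_reps S.

(** Take for W0 a proper submodule of W of largest dimension; then W / W0 is simple and appears in
    the list S. *)
Lemma maximal_subquotient X (W : {vspace X}) : submodule W -> W <> 0%VS ->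
  exists (W0 : {vspace X}) i,
    [/\ submodule W0, (\dim W0 < \dim W)%N & subquotient_iso W0 W (S i)].
Proof.
move=> sW Wn0.
pose good m := `[< exists W0 : {vspace X},
  [/\ submodule W0, (W0 <= W)%VS, W0 <> W & \dim W0 = m] >].
have good_ex : exists m, good m.
  exists 0%N; apply/asboolP; exists 0%VS.
  by split; [apply: submodule0 | apply: sub0v | move/esym | rewrite dimv0].
have good_le m : good m -> (m <= \dim W)%N.
  by move=> /asboolP[W0 [_ /dimvS le _ <-]].
have [m /asboolP[W0 [sW0 W0W W0n dW0]] m_max] := ex_maxnP good_ex good_le.
have lt_dW : (\dim W0 < \dim W)%N.
  rewrite ltn_neqAle dimvS // andbT; apply/eqP => dE.
  by apply/W0n/eqP; rewrite eqEdim W0W dE leqnn.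
have [Q [p [pr pE pk]]] := quotient_exists sW0.
have sI := rhom_img pr sW; pose T := submod sI.
have pT (z : T) : exists2 w, w \in W & submod_incl sI z = p w.
  by have /memv_imgP[w wW ->] := submod_inclP z; exists w.
have inj := submod_incl_mono sI; have /monoP injP := inj.
have incl0 z : (submod_incl sI z == 0) = (z == 0).
  apply/eqP/eqP => [z0|->]; last exact: linear0.
  by apply: injP; rewrite z0 linear0.
(* [subquotient_iso] wants a map on all of X. Only the values of [c] on W matter, where it is [p]
   with codomain p(W). *)
pose c : 'Hom(X, T) := (linfun (vsproj (p @: W)%VS) \o p)%VF.
have cE x : x \in W -> submod_incl sI (c x) = p x.
  by move=> xW; rewrite submod_inclE comp_lfunE lfunE /= vsprojK // memv_img.
have c0 x : x \in W -> (c x == 0) = (x \in W0).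
  by move=> xW; rewrite -pk memv_ker -cE // incl0.
have Tsimple : simple_module T.
  split=> [/zeromodP T0|Z sZ].
    suff: (W <= W0)%VS by move=> /dimvS; rewrite leqNgt lt_dW.
    by apply/subvP => x xW; rewrite -c0 // (T0 (c x)).
  (* The preimage of Z in W contains W0, so by maximality it is W or W0, and Z is everything or
     zero. *)
  pose W1 := (W :&: p @^-1: (submod_incl sI @: Z))%VS.
  have sW1 : submodule W1.
    apply: submodule_cap => //; apply: rhom_preim => //.
    exact/rhom_img/sZ/submod_incl_rhom.
  have ZW1 z w : w \in W -> submod_incl sI z = p w -> (z \in Z) = (w \in W1).
    move=> wW zw; rewrite memv_cap wW -memv_preim -zw /=.
    apply/idP/memv_imgP => [zZ|[z' z'Z /injP->]//].
    by exists z.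
  have [W1W|/eqP W1W] := eqVneq W1 W.
    right; apply/vspaceP => z; rewrite memvf; have [w wW zw] := pT z.
    by rewrite (ZW1 z w) // W1W.
  left; apply/eqP; rewrite -subv0; apply/subvP => z zZ.
  have [w wW zw] := pT z; have W01 : (W0 <= W1)%VS.
    apply/subvP => x; rewrite memv_cap -memv_preim -pk memv_ker => xW0.
    by rewrite (subvP W0W) /= ?(eqP xW0) ?mem0v // -pk memv_ker.
  have W10 : W1 = W0.
    apply/esym/eqP; rewrite eqEdim W01 dW0 m_max //; apply/asboolP.
    by exists W1; split=> //; apply: capvSl.
  rewrite (ZW1 z w) // W10 in zZ.
  by rewrite memv0 -incl0 zw -memv_ker pk.
have [_ _ /(_ T Tsimple)[i [h [hr h0 hE]]]] := S_reps.
exists W0, i; split=> //; exists (h \o c)%VF; split=> [x a xW||].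
- rewrite !(comp_lfunE h) -hr; congr (h _); apply: injP.
  by rewrite submod_incl_rhom !cE ?sW // pr.
- rewrite limg_comp; apply/vspaceP => y; rewrite memvf.
  have /epiP/(_ y)[z <-] := hE; apply: memv_img.
  have [w wW zw] := pT z; suff -> : z = c w by rewrite memv_img.
  by apply: injP; rewrite cE.
apply/vspaceP => x; rewrite memv_cap memv_ker.
apply/andP/idP => [[xW]|xW0].
  rewrite (comp_lfunE h) => /eqP hc; rewrite -c0 //.
  by rewrite -memv0 -h0 memv_ker hc.
have xW := subvP W0W x xW0; split=> //.
by rewrite (comp_lfunE h); move: xW0; rewrite -c0 // => /eqP->; rewrite linear0.
Qed.

Lemma composition_series X (W : {vspace X}) : submodule W ->
  exists l (F : nat -> {vspace X}) (s : 'I_l -> 'I_n),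
  [/\ F 0%N = 0%VS, F l = W, forall k, (k <= l)%N -> submodule (F k)
    & forall k : 'I_l, subquotient_iso (F k) (F k.+1) (S (s k))].
Proof.
have [m] := ubnP (\dim W); elim: m W => // m IHm W le_m sW.
have [->|/eqP Wn0] := eqVneq W 0%VS.
  have s : 'I_0 -> 'I_n by case.
  exists 0%N, (fun _ => 0%VS), s; split=> // [k _|[]//].
  exact: submodule0.
have [W0 [i [sW0 lt_d W0q]]] := maximal_subquotient sW Wn0.
have [l [F [s [F0 Fl Fsub Fq]]]] := IHm W0 (leq_trans lt_d le_m) sW0.
(* The series of W0 is prolonged by W; the last index [ord_max] receives the simple factor W /
   W0. *)
exists l.+1, (fun k => if (k <= l)%N then F k else W).
exists (fun k => if unlift ord_max k is Some j then s j else i).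
split=> [||k|k]; rewrite ?leq0n ?ltnn //.
  by move=> _; case: ifP => // /Fsub.
case: unliftP => [j ->|->]; last by rewrite /= leqnn ltnn Fl.
by rewrite lift_max ltn_ord (ltnW (ltn_ord j)).
Qed.

Lemma dimvec_exists X : exists d, has_dimvec S X d.
Proof.
have [l [F [s [F0 Fl Fsub Fq]]]] := composition_series (@submoduleT _ _ X).
by exists (fun i => #|[set k | s k == i]%SET|), l, F, s.
Qed.

End DimensionVectors.

(** * g-vector forms on Newton polytopes *)

Section NewtonPolytopes.
Variables (K : fieldType) (A : falgType K) (R : realType).
Variables (n : nat) (S : 'I_n -> rmod A) (S_reps : simple_reps S).
Implicit Types M N P Q U V X Y Z : rmod A.

(* The form v |-> <g, v> given by the g-vector of a projective presentation. *)
Definition gform P1 P0 (v : 'rV[R]_n) : R :=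
  \sum_i v 0 i * ((\dim (homA P0 (S i)))%:R - (\dim (homA P1 (S i)))%:R).

Lemma gform_dimvec P1 P0 X d :
  projective P1 -> projective P0 -> has_dimvec S X d ->
  gform P1 P0 (\row_i (d i)%:R) =
    (\dim (homA P0 X))%:R - (\dim (homA P1 X))%:R.
Proof.
move=> P1p P0p Xd; rewrite !(hom_dimvec _ Xd) // !natr_sum -sumrB.
by apply: eq_bigr => i _; rewrite mxE !natrM mulrBr.
Qed.

(** An open half-space stays convex when its boundary point 0 is added. The origin has to be allowed
    because it is the dimension vector of the zero quotient. *)
Lemma gform_pos_convex P1 P0 :
  @convex_set R 'rV[R]_n [set v | v = 0 \/ 0 < gform P1 P0 v]%classic.
Proof.
apply/convex_setW => x y; rewrite !inE /= => xP yP k k0 k1; rewrite inE /=.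
have gE : gform P1 P0 (k%:num *: x + (1 - k%:num) *: y) =
    k%:num * gform P1 P0 x + (1 - k%:num) * gform P1 P0 y.
  rewrite /gform !mulr_sumr -big_split; apply: eq_bigr => i _ /=.
  by rewrite !mxE mulrDl !mulrA.
have pos_conv : 0 < k%:num * gform P1 P0 x + (1 - k%:num) * gform P1 P0 y ->
    0 < gform P1 P0 (conv k (x : convex_lmodType 'rV[R]_n) y).
  by rewrite -gE.
have g0 : gform P1 P0 0 = 0.
  by rewrite /gform big1 // => i _; rewrite mxE mul0r.
have k1' : 0 < 1 - k%:num by rewrite subr_gt0.
case: xP yP => [xE|xP] [yE|yP].
- by left; rewrite xE yE convmm.
- by right; apply: pos_conv; rewrite xE g0 mulr0 add0r mulr_gt0.
- by right; apply: pos_conv; rewrite yE g0 mulr0 addr0 mulr_gt0.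
by right; apply: pos_conv; rewrite addr_gt0 ?mulr_gt0.
Qed.

(* Quotients of U lie in Fac M, so the g-vector form of M is positive on
   N(U) \ {0}; on the quotient of V by its torsion part it is nonpositive. *)
Lemma Fac_newton P1 P0 M (f : 'Hom(P1, P0)) (g : 'Hom(P0, M)) U V :
  presentation f g -> extendable f M -> newton R S U = newton R S V ->
  Fac M U -> Fac M V.
Proof.
move=> fgP fM eqN MU; have [[P1p P0p] _ _ _ _] := fgP.
have [Q [p [pr pE pk]]] := quotient_exists (@trace_submodule _ _ M V).
have Q0 := trace_quotient_hom_zero fgP fM pr pE pk.
have [d Qd] := dimvec_exists S_reps Q.
have NV : newton R S V (\row_i (d i)%:R).
  by apply: sub_gen_smallest; exists Q, p, d.
suff Qzero : zeromod Q.
  apply/Fac_trace/vspaceP => v; rewrite -pk memv_ker memvf.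
  by move/zeromodP/(_ (p v)): Qzero => ->; rewrite eqxx.
(* By convexity it suffices to treat the dimension vectors of quotients X of U, where the form
   equals dim Hom(M, X). *)
have pos : (newton R S U `<=` [set v | v = 0 \/ 0 < gform P1 P0 v])%classic.
  apply: smallest_sub; first exact: gform_pos_convex.
  move=> _ [X [h [e [hr hE Xe ->]]]] /=; have MX := Fac_quot hr hE MU.
  rewrite (gform_dimvec P1p P0p Xe).
  rewrite (hom_dim_extendable fgP (extendable_Fac P1p fM MX)) natrD addrK.
  rewrite ltr0n lt0n; case: eqP => [/hom_zero_dim X0|]; last by right.
  have /zeromodP X_0 := Fac_hom_zero MX X0.
  left; apply/rowP => i; rewrite !mxE; apply/eqP; rewrite pnatr_eq0.
  (* A composition factor of the zero module would be a nonzero module that is a linear image of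
     zero. *)
  case: Xe => l [F [s [F0 Fl _ Fq dE]]]; rewrite dE cards_eq0.
  apply/eqP/setP => k; rewrite !inE; apply/negP => _.
  have [q [_ qE _]] := Fq k; have [simp _ _] := S_reps.
  have [+ _] := simp (s k); apply; apply/eqP; rewrite dimv_eq0.
  rewrite -subv0 -qE; apply/subvP => _ /memv_imgP[x _ ->].
  by rewrite (X_0 x) linear0 mem0v.
have := NV; rewrite -eqN => /pos[/rowP d0|].
  apply: (dimvec_eq0 Qd) => i; have := d0 i; rewrite !mxE => /eqP.
  by rewrite pnatr_eq0 => /eqP.
(* Positivity at Q contradicts [hom_dim_le], because Hom(M, Q) = 0. *)
rewrite (gform_dimvec P1p P0p Qd) subr_gt0 ltr_nat => lt_hom.
have := hom_dim_le fgP Q; have /hom_zero_dim-> := Q0; rewrite add0n.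
by rewrite leqNgt lt_hom.
Qed.

End NewtonPolytopes.

(** * Duality between Hom(X, D L) and extension of maps along a presentation, for L the cokernel of
    the transposed map *)

Section Transpose.
Variables (K : fieldType) (A : falgType K).
Implicit Types M N P Q U V X Y Z : rmod A.

(** A splitting of an epimorphism from a free module onto P gives both families: the images of the
    standard generators and the coordinates of the splitting. *)
Lemma dual_basis P : projective P ->
  exists k (u : 'I_k -> P) (h : 'I_k -> 'Hom(P, regmod A)),
    (forall i, rhom (h i)) /\ forall x, x = \sum_i ract (u i) (h i x).
Proof.
move=> Pp; have /Fac_power[k [e [er eE]]] := Fac_regmod P.
have [s sr sE] := Pp _ _ e _ er eE (@rhom_id _ _ P).
exists k, (fun i => e (pinj (regmod A) i 1)), (fun i => pproj (regmod A) i \o s)%VF.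
split=> [i|x]; first exact/rhom_comp/pproj_rhom.
rewrite -{1}[x]id_lfunE -sE comp_lfunE [s x]power_split linear_sum.
apply: eq_bigr => i _; rewrite -er -(@pinj_rhom _ _ (regmod A)) comp_lfunE.
by rewrite /= mul1r.
Qed.

Lemma functional_exists (V : vectType K) (v : V) :
  v != 0 -> exists l : 'Hom(V, K^o), l v != 0.
Proof.
move=> vn0; pose b := vbasis {:V}.
have /existsP[i cv] : [exists i, coord b i v != 0].
  apply: contraNT vn0; rewrite negb_exists => /forallP c0.
  rewrite (coord_vbasis (memvf v)) big1 // => i _.
  by have := c0 i; rewrite negbK => /eqP->; rewrite scale0r.
by exists (linfun (coord b i : V -> K^o)); rewrite lfunE.
Qed.

Definition star_elt P (h : 'Hom(P, regmod A)) (hr : rhom h) : star P :=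
  Subvs (introT (homAP h) hr).

(** The image of the tensor of x and h under the canonical map from the tensor product of X and
    [star P] over A to Hom(P, X). [outer_ract] is its balancedness. *)
Definition outer P X (x : X) : 'Hom(star P, 'Hom(P, X)) :=
  linfun (fun h : star P => (linfun (ract x) \o vsval h)%VF).

Lemma outerE P X (x : X) (h : star P) u : outer P x h u = ract x (vsval h u).
Proof.
rewrite /outer linfun_linE => [|k a b]; last first.
  by apply/lfunP => y; rewrite linearP !(comp_lfunE, add_lfunE, scale_lfunE) linearP.
by rewrite comp_lfunE ract_rE.
Qed.

Lemma outer_ract P X (x : X) a (h : star P) :
  outer P (ract x a) h = outer P x (lact a h).
Proof. by apply/lfunP => u; rewrite !outerE star_actE ractM. Qed.

Variables (P1 P0 : rmod A) (f : 'Hom(P1, P0)) (L : lmod A) (p : 'Hom(star P1, L)).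
Hypotheses (P1p : projective P1) (P0p : projective P0).
Hypotheses (fr : rhom f) (pl : lhom p) (pE : is_epi p).
Hypothesis pk : forall h : star P1,
  p h = 0 <-> exists h0 : star P0, vsval h = (vsval h0 \o f)%VF.

Let pS y : p (p^-1%VF y) = y.
Proof. by rewrite limg_lfunVK // (pE : limg p = _) memvf. Qed.

(** A map X -> D L amounts to a balanced pairing [B] of X with [star P1] that vanishes on the image
    of [star P0]. Extending u |-> x h(u) along [f] and expanding in dual bases rewrites [B x h] as a
    sum of values of [B] at elements [h0 j \o f] of that image. *)
Lemma extendable_hom_zero X : extendable f X -> hom_zero X (kdual L).
Proof.
move=> fX phi phir.
have [k1 [u1 [h1 [h1r u1E]]]] := dual_basis P1p.
have [k0 [u0 [h0 [h0r u0E]]]] := dual_basis P0p.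
pose B x (h : star P1) : K^o := (phi x : 'Hom(L, K^o)) (p h).
have Ba x a h : B (ract x a) h = B x (lact a h).
  by rewrite /B phir pl [LHS]dual_actE.
have Bsuml I (r : seq I) (F : I -> X) h :
    B (\sum_(i <- r) F i) h = \sum_(i <- r) B (F i) h.
  by rewrite /B linear_sum sum_lfunE.
have Bsumr I (r : seq I) x (F : I -> star P1) :
    B x (\sum_(i <- r) F i) = \sum_(i <- r) B x (F i).
  by rewrite /B !linear_sum.
have hE (h : star P1) : h = \sum_i lact (vsval h (u1 i)) (star_elt (h1r i)).
  apply/val_inj/lfunP => x; rewrite /= linear_sum sum_lfunE {1}[x]u1E linear_sum.
  apply: eq_bigr => i _; rewrite star_actE /=.
  by have /homAP-> := valP h.
apply/lfunP => x; apply/lfunP => y; rewrite -[y]pS.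
have [h <-] : exists h, h = (p^-1)%VF y by exists ((p^-1)%VF y).
rewrite zero_lfunE -[LHS]/(B x h) [RHS]zero_lfunE.
have outr : rhom (outer P1 x h).
  by move=> u a; rewrite !outerE -ractM; have /homAP-> := valP h.
have [l lr lE] := fX _ outr.
(* Here [f (u1 i)] is expanded in the dual basis of [P0], and [l] restricts along [f] to u |-> x
   h(u). *)
have xh i : ract x (vsval h (u1 i)) = \sum_j ract (l (u0 j)) (h0 j (f (u1 i))).
  rewrite -outerE -lE comp_lfunE {1}[f _]u0E linear_sum.
  by apply: eq_bigr => j _; rewrite /= lr.
rewrite {1}[h]hE Bsumr.
under eq_bigr do rewrite -Ba xh Bsuml.
rewrite exchange_big big1 // => j _.
have hjr : rhom (h0 j \o f)%VF by apply: rhom_comp.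
have pj0 : p (star_elt hjr) = 0 by apply/pk; exists (star_elt (h0r j)).
have -> : \sum_(i < k1) B (ract (l (u0 j)) (h0 j (f (u1 i)))) (star_elt (h1r i)) =
    B (l (u0 j)) (star_elt hjr).
  rewrite [star_elt hjr]hE Bsumr; apply: eq_bigr => i _.
  by rewrite Ba /= comp_lfunE.
by rewrite /B pj0 linear0.
Qed.

(** If k did not extend, a linear form [lam] would vanish on the extendable maps but not at k.
    Paired with [outer], it defines a homomorphism X -> D L, which is zero; but the outer maps span
    Hom(P1, X), so [lam] would vanish at k as well. *)
Lemma hom_zero_extendable X : hom_zero X (kdual L) -> extendable f X.
Proof.
move=> X0 k kr; pose I := (precomp X f @: homA P0 X)%VS.
have [/memv_imgP[l /homAP lr ->]|kI] := boolP (k \in I).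
  by exists l; rewrite ?precompE.
have k'n0 : k - projv I k != 0.
  by apply: contra kI => /eqP/subr0_eq->; apply: memv_proj.
have [c cE] := functional_exists k'n0.
pose lam : 'Hom('Hom(P1, X), K^o) := (c \o (\1%VF - projv I)%R)%VF.
have lamE h : lam h = c (h - projv I h).
  by rewrite comp_lfunE add_lfunE opp_lfunE id_lfunE.
have lamI h : h \in I -> lam h = 0.
  by move=> hI; rewrite lamE projv_id // subrr linear0.
have lam_outer x (h : star P1) : p h = 0 -> lam (outer P1 x h) = 0.
  move=> /pk[h0 hE]; apply: lamI; apply/memv_imgP.
  exists (outer P0 x h0).
    by apply/homAP => u a; rewrite !outerE -ractM; have /homAP-> := valP h0.
  by rewrite precompE; apply/lfunP => u; rewrite comp_lfunE !outerE hE comp_lfunE.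
(* [p^-1] is only a linear section of [p]; by [lam_outer] the choice of preimage is irrelevant,
   whence A-linearity. *)
pose F x : kdual L := (lam \o outer P1 x \o p^-1)%VF.
have FE x y : (F x : 'Hom(L, K^o)) y = lam (outer P1 x (p^-1%VF y)).
  by rewrite !comp_lfunE.
have Flin : linear F.
  move=> a x y; apply/lfunP => z; rewrite add_lfunE scale_lfunE !FE -linearP.
  congr (lam _); apply/lfunP => u.
  by rewrite add_lfunE scale_lfunE !outerE ractDl ractZl.
have Fr : rhom (linfun F).
  move=> x a; rewrite !linfun_linE //; apply/lfunP => y.
  rewrite FE [RHS]dual_actE FE outer_ract; apply/eqP; rewrite -subr_eq0 -!linearB.
  by apply/eqP/lam_outer; rewrite linearB /= pl !pS subrr.
have F0 x h : lam (outer P1 x h) = 0.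
  have /lfun_eqP/(_ x) := X0 _ Fr.
  rewrite linfun_linE // zero_lfunE => /lfun_eqP/(_ (p h)).
  rewrite FE [RHS]zero_lfunE => <-; apply/eqP; rewrite -subr_eq0 -!linearB.
  by apply/eqP/lam_outer; rewrite linearB /= pS subrr.
have [k1 [u1 [h1 [h1r u1E]]]] := dual_basis P1p.
have kE : k = \sum_i outer P1 (k (u1 i)) (star_elt (h1r i)).
  apply/lfunP => x; rewrite {1}[x]u1E linear_sum sum_lfunE.
  by apply: eq_bigr => i _; rewrite outerE /= kr.
case/eqP: cE; rewrite -lamE kE linear_sum big1 // => i _.
exact: F0.
Qed.

End Transpose.

(** * tau-rigidity through minimal presentations, and direct sums of these *)

Section TauRigid.
Variables (K : fieldType) (A : falgType K).
Implicit Types (L : lmod A) (M N P Q U V X Y Z T : rmod A).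

Lemma lmod_quotient_exists L (W : {vspace L}) :
  (forall a x, x \in W -> lact a x \in W) ->
  exists (L' : lmod A) (p : 'Hom(L, L')), [/\ lhom p, is_epi p & lker p = W].
Proof.
move=> sW; have [C [p [pE pk]]] := linear_quotient_exists W.
have p0 x : (p x == 0) = (x \in W) by rewrite -memv_ker pk.
have pS y : p (p^-1%VF y) = y by rewrite limg_lfunVK // (pE : limg p = _) memvf.
have lactBr a (x y : L) : lact a (x - y) = lact a x - lact a y.
  by rewrite -!lactEE linearB.
pose act (a : A) (y : C) : C := p (lact a (p^-1%VF y)).
have actE a x : act a (p x) = p (lact a x).
  apply/eqP; rewrite -subr_eq0 -linearB -lactBr p0 sW //.
  by rewrite -p0 linearB /= pS subrr.
have pW (y : C) : exists x, y = p x by exists (p^-1%VF y).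
have lin_l y : linear (act ^~ y).
  move=> k a b; have [u ->] := pW y.
  by rewrite !actE lact_linearl linearP.
have lin_r a : linear (act a).
  move=> k y z; have [[u ->] [v ->]] := (pW y, pW z).
  by rewrite -linearP !actE lact_linearr linearP.
have act1 y : act 1 y = y by have [u ->] := pW y; rewrite actE lact1.
have actM a b y : act (a * b) y = act a (act b y).
  by have [u ->] := pW y; rewrite !actE lactM.
by exists (LMod lin_l lin_r act1 actM), p; split=> [a x||] //; rewrite /= actE.
Qed.

Lemma hom_zero_riso X T T' : riso T T' -> hom_zero X T' -> hom_zero X T.
Proof.
move=> [i [ir i0 _]] X0 h hr; have := X0 _ (rhom_comp hr ir).
move=> /lfun_eqP ih0; apply/lfunP => x; have /monoP := i0; apply.
by have := ih0 x; rewrite comp_lfunE !zero_lfunE linear0.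
Qed.

Lemma min_presentation_presentation P1 P0 M (f : 'Hom(P1, P0)) (g : 'Hom(P0, M)) :
  min_proj_presentation f g -> presentation f g.
Proof. by case=> [[P0p gr gE _] [P1p fr fE _]]. Qed.

(** Both directions translate Hom(M, tau M) = 0 by the duality just proved. For the converse a
    transpose must be supplied: it is the cokernel of h |-> [h \o f] from [star P0] to [star P1]. *)
Lemma tau_rigidP M : tau_rigid M <->
  exists P1 P0 (f : 'Hom(P1, P0)) (g : 'Hom(P0, M)),
    min_proj_presentation f g /\ extendable f M.
Proof.
split=> [[T [L [P1 [P0 [f [g [p [fg pl pE pk]]]]]] TL] M0]|[P1 [P0 [f [g [fg fM]]]]]].
  exists P1, P0, f, g; split=> //.
  have [[P1p P0p] fr _ _ _] := min_presentation_presentation fg.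
  exact/(hom_zero_extendable P1p pl pE pk)/(hom_zero_riso (riso_sym TL)).
have [[P1p P0p] fr _ _ _] := min_presentation_presentation fg.
have vr (h : star P0) : rhom (vsval h \o f)%VF.
  by apply: rhom_comp => //; apply/homAP/subvsP.
pose F (h : star P0) : star P1 := star_elt (vr h).
have FE h : vsval (F h) = (vsval h \o f)%VF by [].
have Flin : linear F.
  move=> k h h'; apply/val_inj/lfunP => x /=.
  by rewrite !(comp_lfunE, add_lfunE, scale_lfunE, linearP).
have sI a h : h \in limg (linfun F) -> lact a h \in limg (linfun F).
  move=> /memv_imgP[h0 _ ->]; apply/memv_imgP; exists (lact a h0); rewrite ?memvf //.
  rewrite !linfun_linE //; apply/val_inj/lfunP => x.
  by rewrite [LHS]star_actE [RHS]comp_lfunE [RHS]star_actE /= comp_lfunE.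
have [L [p [pl pE pk]]] := lmod_quotient_exists sI.
have pk' h : p h = 0 <-> exists h0 : star P0, vsval h = (vsval h0 \o f)%VF.
  split=> [/eqP|[h0 hE]].
    rewrite -memv_ker pk => /memv_imgP[h0 _ ->].
    by exists h0; rewrite linfun_linE.
  apply/eqP; rewrite -memv_ker pk; apply/memv_imgP; exists h0; rewrite ?memvf //.
  by rewrite linfun_linE //; apply/val_inj.
exists (kdual L); last exact: (extendable_hom_zero P1p P0p fr pl pE pk').
by exists L; [exists P1, P0, f, g, p | apply: riso_refl].
Qed.

Lemma superfluous_img P X Y (f : 'Hom(P, X)) (W : {vspace X}) (i : 'Hom(P, Y))
    (Q : {vspace Y}) :
  proj_cover f W -> rhom i -> submodule Q -> (Q + i @: lker f = fullv)%VS ->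
  Q = fullv.
Proof.
move=> [_ fr fW fmin] ir sQ QE.
have iQ : (i @^-1: Q)%VS = fullv.
  apply: fmin; first exact: rhom_preim.
  rewrite -fW; apply/eqP; rewrite eqEsubv limgS ?subvf //=.
  apply/subvP => _ /memv_imgP[x _ ->].
  have /memv_addP[q qQ [_ /memv_imgP[z zk ->] ixE]] : i x \in (Q + i @: lker f)%VS.
    by rewrite QE memvf.
  have -> : f x = f (x - z).
    by move: zk; rewrite memv_ker linearB /= => /eqP->; rewrite subr0.
  by rewrite memv_img // -memv_preim linearB /= ixE addrK.
apply/eqP; rewrite eqEsubv subvf -QE subv_add subvv /=.
apply/subvP => _ /memv_imgP[x _ ->].
by rewrite memv_preim iQ memvf.
Qed.

Lemma proj_cover_dsum P P' X X' (f : 'Hom(P, X)) (f' : 'Hom(P', X')) W W' :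
  proj_cover f W -> proj_cover f' W' ->
  proj_cover (dsum_map f f') (limg (dsum_map f f')).
Proof.
move=> fP fP'; have [[Pp fr _ _] [Pp' fr' _ _]] := (fP, fP').
split=> // [||Q sQ QE]; [exact: dsum_projective | exact: dsum_map_rhom |].
have inlr := @dinl_rhom _ _ P P'; have inrr := @dinr_rhom _ _ P P'.
apply: (superfluous_img fP inlr sQ).
apply: (superfluous_img fP' inrr).
  exact/submodule_add/rhom_img/rhom_ker/fr.
apply/vspaceP => x; rewrite memvf.
have /memv_imgP[q qQ qE] : dsum_map f f' x \in (dsum_map f f' @: Q)%VS.
  by rewrite QE memv_img ?memvf.
have : dsum_map f f' (x - q) = 0 by rewrite linearB /= qE subrr.
rewrite dsum_mapE => -[k1 k2]; rewrite -[x](subrK q) addrC (dsum_split (x - q)) addrA.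
by rewrite !memv_add // memv_img // memv_ker ?k1 ?k2.
Qed.

(** The direct sum of the two minimal presentations is again minimal, and maps extend along it
    componentwise. *)
Lemma tau_rigid_dsum_of P1 P0 Q1 Q0 U V
    (f : 'Hom(P1, P0)) (g : 'Hom(P0, U)) (f' : 'Hom(Q1, Q0)) (g' : 'Hom(Q0, V)) :
  min_proj_presentation f g -> min_proj_presentation f' g' ->
  extendable f (dsum U V) -> extendable f' (dsum U V) -> tau_rigid (dsum U V).
Proof.
move=> [gP fP] [gP' fP'] fE fE'; apply/tau_rigidP.
exists (dsum P1 Q1), (dsum P0 Q0), (dsum_map f f'), (dsum_map g g').
have [[_ fr fg _] [_ _ gE _]] := (fP, gP).
have [[_ fr' fg' _] [_ _ gE' _]] := (fP', gP').
split; last first.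
  move=> k kr; have [l lr lE] := fE _ (rhom_comp (@dinl_rhom _ _ P1 Q1) kr).
  have [l' lr' lE'] := fE' _ (rhom_comp (@dinr_rhom _ _ P1 Q1) kr).
  exists (copair l l'); first exact: copair_rhom.
  apply/lfunP => x; rewrite comp_lfunE dsum_mapE copairE -2!comp_lfunE lE lE'.
  by rewrite !comp_lfunE -linearD -dsum_split.
have gE2 : limg (dsum_map g g') = fullv.
  apply/epiP => -[y y']; have /epiP/(_ y)[x <-] := gE.
  by have /epiP/(_ y')[x' <-] := gE'; exists (x, x'); rewrite dsum_mapE.
split; first by rewrite -gE2; apply: proj_cover_dsum gP gP'.
have -> : lker (dsum_map g g') = limg (dsum_map f f').
  apply/vspaceP => -[x x']; rewrite memv_ker dsum_mapE.
  apply/eqP/memv_imgP => [[/eqP gx /eqP gx']|[[y y'] _ ->]].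
    move: gx gx'; rewrite -!memv_ker -fg -fg'.
    move=> /memv_imgP[y _ ->] /memv_imgP[y' _ ->].
    by exists (y, y'); rewrite ?memvf // dsum_mapE.
  have gf z : g (f z) = 0.
    by apply/eqP; rewrite -memv_ker -fg memv_img ?memvf.
  have gf' z : g' (f' z) = 0.
    by apply/eqP; rewrite -memv_ker -fg' memv_img ?memvf.
  by rewrite dsum_mapE /= gf gf'.
exact: proj_cover_dsum fP fP'.
Qed.

Lemma extendable_dsum P1 P0 (f : 'Hom(P1, P0)) U V :
  extendable f U -> extendable f V -> extendable f (dsum U V).
Proof.
move=> fU fV k kr.
have [l lr lE] := fU _ (rhom_comp kr (@dfst_rhom _ _ U V)).
have [l' lr' lE'] := fV _ (rhom_comp kr (@dsnd_rhom _ _ U V)).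
exists ((dinl U V \o l) + (dinr U V \o l'))%VF.
  by apply: rhomD; apply: rhom_comp => //; [apply: dinl_rhom | apply: dinr_rhom].
rewrite comp_lfunDl -!comp_lfunA lE lE' !comp_lfunA -comp_lfunDl dsum_id.
by rewrite comp_lfun1l.
Qed.

End TauRigid.

(** * Torsion classes generated by bricks *)

Section Bricks.
Variables (K : fieldType) (A : falgType K).
Implicit Types M N P Q U V W X Y Z T : rmod A.

Lemma tors_torsion_class N : torsion_class (tors N).
Proof.
split=> [X Y f fr fE NX T Tt TN|X Y Z f g fr gr f0 gE fg NX NZ T Tt TN].
  by have [+ _] := Tt; apply; [apply: fr | apply: fE | apply: NX].
have [_ +] := Tt; apply; [exact: fr | exact: gr | | | | exact: NX | exact: NZ] => //.
Qed.

Lemma comp_epi_eq0 X Y Z (p : 'Hom(X, Y)) (h : 'Hom(Y, Z)) :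
  is_epi p -> (h \o p)%VF = 0 -> h = 0.
Proof.
move=> /epiP pE hp0; apply/lfunP => y; have [x <-] := pE y.
by rewrite -comp_lfunE hp0 !zero_lfunE.
Qed.

Lemma comp_epi_epi X Y Z (p : 'Hom(X, Y)) (h : 'Hom(Y, Z)) :
  is_epi (h \o p)%VF -> is_epi h.
Proof.
move=> /epiP hp; apply/epiP => z; have [x <-] := hp z.
by exists (p x); rewrite comp_lfunE.
Qed.

Lemma factor_coker X Y Z V (f : 'Hom(X, Y)) (g : 'Hom(Y, Z)) (h : 'Hom(Y, V)) :
  rhom g -> is_epi g -> limg f = lker g -> rhom h -> (h \o f)%VF = 0 ->
  exists2 h' : 'Hom(Z, V), rhom h' & (h' \o g = h)%VF.
Proof.
move=> gr gE fg hr hf0; apply: factor_epi => //.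
rewrite -fg; apply/subvP => _ /memv_imgP[x _ ->].
by rewrite memv_ker -comp_lfunE hf0 zero_lfunE.
Qed.

(** The modules without nonzero maps to X form a torsion class. It contains N, hence X, so the
    identity of X is zero. *)
Lemma tors_hom_zero N X : tors N X -> hom_zero N X -> zeromod X.
Proof.
move=> NX N0; suff /(_ _ (@rhom_id _ _ X)) id0 : hom_zero X X.
  by apply/zeromodP => x; rewrite -[x]id_lfunE id0 zero_lfunE.
apply: (NX (fun Y => hom_zero Y X)) => //; split.
  by move=> Y Z f fr fE Y0 h hr; apply: (comp_epi_eq0 fE); apply/Y0/rhom_comp.
move=> Y Z V f g fr gr _ gE fg Y0 V0 h hr.
have [|h' h'r <-] := factor_coker gr gE fg hr; first exact/Y0/rhom_comp.
by rewrite (V0 _ h'r) comp_lfun0l.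
Qed.

(** The modules all of whose maps to N are zero or onto form a torsion class, which contains N
    because N is a brick. *)
Lemma tors_brick_hom N X (h : 'Hom(X, N)) :
  brick N -> tors N X -> rhom h -> h = 0 \/ is_epi h.
Proof.
move=> [_ Nb] NX; move: h.
apply: (NX (fun Y => forall h : 'Hom(Y, N), rhom h -> h = 0 \/ is_epi h)); first split.
- move=> Y Z f fr fE YP h hr.
  have [hf0|hfE] := YP _ (rhom_comp fr hr); last by right; apply: comp_epi_epi hfE.
  by left; apply: comp_epi_eq0 hf0.
- move=> Y Z V f g fr gr _ gE fg YP VP h hr.
  have [hf0|hfE] := YP _ (rhom_comp fr hr); last by right; apply: comp_epi_epi hfE.
  have [h' h'r hE] := factor_coker gr gE fg hr hf0.
  have [h'0|h'E] := VP _ h'r; first by left; rewrite -hE h'0 comp_lfun0l.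
  by right; rewrite -hE; apply: comp_epi.
move=> h hr; have [->|hn0] := eqVneq h 0; first by left.
right; have [g [_ _ hg]] := Nb h hr hn0.
by apply: (@comp_epi_epi _ _ _ g); rewrite hg; apply: lim1g.
Qed.

(** A nonzero map exists in each direction and is onto; comparing dimensions makes both of them
    isomorphisms. *)
Lemma brick_riso U V : brick U -> brick V -> tors U V -> tors V U -> riso U V.
Proof.
move=> Ub Vb UV VU.
have epi X Y : brick X -> brick Y -> tors X Y -> tors Y X ->
    exists2 h : 'Hom(X, Y), rhom h & is_epi h.
  move=> _ Yb XY YX; apply: contrapT => noh; have [Yn0 _] := Yb.
  apply/Yn0/(tors_hom_zero XY) => h hr.
  by have [//|hE] := tors_brick_hom Yb YX hr; case: noh; exists h.
have [h hr hE] := epi U V Ub Vb UV VU; have [k kr kE] := epi V U Vb Ub VU UV.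
by exists h; split=> //; apply: epi_mono_dim => //; apply: epi_dim kE.
Qed.

End Bricks.

(** * Fitting's lemma, local endomorphism rings and Nakayama's lemma *)

Section Fitting.
Variables (K : fieldType) (A : falgType K).
Implicit Types M N P Q U V W X Y Z T : rmod A.

Definition lpow (X : vectType K) (e : 'End(X)) k : 'End(X) :=
  iter k (comp_lfun e) \1%VF.

Lemma lpowD (X : vectType K) (e : 'End(X)) k m :
  lpow e (k + m) = (lpow e k \o lpow e m)%VF.
Proof.
by elim: k => [|k IHk]; rewrite ?comp_lfun1l // addSn /= IHk comp_lfunA.
Qed.

Lemma lpowSr (X : vectType K) (e : 'End(X)) k : lpow e k.+1 = (lpow e k \o e)%VF.
Proof. by rewrite -addn1 lpowD /= comp_lfun1r. Qed.

Lemma lpow_rhom U (e : 'End(U)) k : rhom e -> rhom (lpow e k).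
Proof.
by move=> er; elim: k => [|k IHk]; [apply: rhom_id | apply: rhom_comp].
Qed.

(** A positive power E whose image has least dimension maps that image onto itself, hence
    injectively. Writing E x = E (E y) splits x into E y and x - E y. The exponent is positive so
    that ker E contains ker e and the image of E lies in that of e. *)
Lemma fitting (X : vectType K) (e : 'End(X)) : exists k,
  (limg (lpow e k.+1) :&: lker (lpow e k.+1) = 0)%VS /\
  (limg (lpow e k.+1) + lker (lpow e k.+1) = fullv)%VS.
Proof.
pose dimk m := `[< exists k, \dim (limg (lpow e k.+1)) = m >].
have dim_ex : exists m, dimk m.
  by exists (\dim (limg (lpow e 1))); apply/asboolP; exists 0%N.
have [m /asboolP[k dk] m_min] := ex_minnP dim_ex.
pose E := lpow e k.+1; exists k; rewrite -/E.
have EE : (E @: limg E)%VS = limg E.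
  apply/eqP; rewrite eqEdim limgS ?subvf //= [X in (X <= _)%N]dk m_min //.
  apply/asboolP; exists (k + k.+1)%N.
  by rewrite -addSn lpowD limg_comp.
split; first last.
  apply/vspaceP => x; rewrite memvf.
  have /memv_imgP[_ /memv_imgP[y _ ->] xE] : E x \in (E @: limg E)%VS.
    by rewrite EE memv_img ?memvf.
  rewrite -[x](subrK (E y)) addrC memv_add ?memv_img ?memvf //.
  by rewrite memv_ker linearB /= xE subrr.
apply/eqP; rewrite -dimv_eq0 -leqn0.
by rewrite -(leq_add2r (\dim (E @: limg E))) limg_ker_dim EE.
Qed.

Lemma internal_dsum U (W W' : {vspace U}) (sW : submodule W) (sW' : submodule W') :
  (W :&: W' = 0)%VS -> (W + W' = fullv)%VS ->
  riso U (dsum (submod sW) (submod sW')).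
Proof.
move=> WW'0 WW'; apply: riso_sym.
exists (copair (submod_incl sW) (submod_incl sW')); split.
- by apply: copair_rhom; apply: submod_incl_rhom.
- apply/eqP; rewrite -subv0; apply/subvP => -[x y].
  rewrite memv_ker copairE /= addr_eq0 => /eqP xy; rewrite memv0.
  have x0 : submod_incl sW x = 0.
    apply/eqP; rewrite -memv0 -WW'0 memv_cap submod_inclP.
    by rewrite xy memvN submod_inclP.
  have y0 : submod_incl sW' y = 0 by apply/eqP; rewrite -oppr_eq0 -xy x0.
  have /monoP iW := submod_incl_mono sW; have /monoP iW' := submod_incl_mono sW'.
  have -> : x = 0 by apply: iW; rewrite x0 linear0.
  by have -> : y = 0 by apply: iW'; rewrite y0 linear0.
apply/epiP => u; have /memv_addP[w wW [w' wW' ->]] : u \in (W + W')%VS.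
  by rewrite WW' memvf.
move: wW wW'; rewrite -{1}(submod_incl_img sW) -{1}(submod_incl_img sW').
by move=> /memv_imgP[x _ ->] /memv_imgP[y _ ->]; exists (x, y); rewrite copairE.
Qed.

Lemma zeromod_submod U (W : {vspace U}) (sW : submodule W) :
  zeromod (submod sW) -> W = 0%VS.
Proof. by rewrite /zeromod submod_dim => /eqP; rewrite dimv_eq0 => /eqP. Qed.

Lemma indecomposable_internal U (W W' : {vspace U}) :
  indecomposable U -> submodule W -> submodule W' ->
  (W :&: W' = 0)%VS -> (W + W' = fullv)%VS -> W = 0%VS \/ W' = 0%VS.
Proof.
move=> [_ Ui] sW sW' WW'0 WW'.
by have [/zeromod_submod|/zeromod_submod] := Ui _ _ (internal_dsum sW sW' WW'0 WW');
  [left | right].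
Qed.

Lemma indecomposable_endo U (e : 'End(U)) :
  indecomposable U -> rhom e -> (exists k, lpow e k = 0) \/ is_mono e.
Proof.
move=> Ui er; have [k [E0 EU]] := fitting e; have Er := lpow_rhom k.+1 er.
have [I0|k0] := indecomposable_internal Ui (rhom_limg Er) (rhom_ker Er) E0 EU.
  left; exists k.+1; apply/lfunP => x; apply/eqP.
  by rewrite zero_lfunE -memv0 -I0 memv_img ?memvf.
right; apply/eqP; rewrite -subv0 -k0; apply/subvP => x; rewrite !memv_ker.
by move=> /eqP ex; rewrite lpowSr comp_lfunE ex linear0.
Qed.

Definition singular U (e : 'End(U)) : Prop := rhom e /\ ~ is_mono e.

Lemma endo_epi U (e : 'End(U)) : is_mono e <-> is_epi e.
Proof. by split=> [/mono_epi_dim|/epi_mono_dim]; apply. Qed.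

Lemma singular_compl U (e g : 'End(U)) : rhom g -> singular e -> singular (g \o e)%VF.
Proof.
move=> gr [er en]; split; first exact: rhom_comp.
by move=> /monoP ge; apply/en/monoP => x y exy; apply: ge; rewrite !comp_lfunE exy.
Qed.

Lemma singular_compr U (e g : 'End(U)) : rhom g -> singular e -> singular (e \o g)%VF.
Proof.
move=> gr [er en]; split; first exact: rhom_comp.
by move=> /endo_epi ge; apply/en/endo_epi/comp_epi_epi/ge.
Qed.

Lemma endo_inv U (e : 'End(U)) : rhom e -> is_mono e ->
  exists g : 'End(U), [/\ rhom g, (g \o e = \1)%VF & (e \o g = \1)%VF].
Proof.
move=> er e0; exists (e^-1)%VF; split.
- by apply: rhom_inv => //; apply/endo_epi.
- by apply: lker0_compVf; apply/eqP.
by apply: lker0_compfV; apply/eqP.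
Qed.

(* The endomorphism ring of an indecomposable module is local. *)
Lemma singularD U (e e' : 'End(U)) :
  indecomposable U -> singular e -> singular e' -> singular (e + e').
Proof.
move=> Ui es es'; have [[er _] [e'r e'n]] := (es, es').
split; first exact: rhomD.
move=> s0; have [t [tr ts st]] := endo_inv (rhomD er e'r) s0.
have [ter ten] := singular_compl tr es.
have [[k tek]|//] := indecomposable_endo Ui ter.
have [_] := singular_compl tr es'; apply; apply/eqP; rewrite -subv0; apply/subvP => x.
rewrite memv_ker memv0 => /eqP x0.
(* Since [t \o e] and [t \o e'] add up to the identity, x is fixed by [t \o e], which is nilpotent;
   so x = 0. *)
have tex : (t \o e)%VF x = x.
  by rewrite -[RHS]id_lfunE -ts comp_lfunDr add_lfunE x0 addr0.
rewrite -(zero_lfunE _ x) -tek eq_sym; apply/eqP.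
by elim: k {tek} => [|k IHk]; rewrite ?id_lfunE // lpowSr comp_lfunE tex.
Qed.

Lemma singular0 U : ~ zeromod U -> singular (0 : 'End(U)).
Proof.
move=> Un; split; first exact: rhom0.
move=> /monoP inj0; apply/Un/zeromodP => x; apply: inj0.
by rewrite !zero_lfunE.
Qed.

(** Linear combinations of [s] with operator coefficients in [C]; recursion on [s] allows generators
    to be discarded one at a time. *)
Fixpoint comb U (C : 'End(U) -> Prop) (s : seq U) (u : U) : Prop :=
  if s is v :: s' then exists2 e, C e & comb C s' (u - e v) else u = 0.

Lemma combD U (C : 'End(U) -> Prop) s u w :
  (forall e e', C e -> C e' -> C (e + e')) ->
  comb C s u -> comb C s w -> comb C s (u + w).
Proof.
move=> CD; elim: s u w => [u w -> ->|v s IHs u w [e Ce us] [e' Ce' ws]] /=.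
  exact: addr0.
by exists (e + e'); [apply: CD | rewrite add_lfunE opprD addrACA; apply: IHs].
Qed.

Lemma comb_map U (C D : 'End(U) -> Prop) (h : 'End(U)) s u :
  (forall e, C e -> D (h \o e)%VF) -> comb C s u -> comb D s (h u).
Proof.
move=> CD; elim: s u => [u ->|v s IHs u [e Ce us]] /=; first exact: linear0.
by exists (h \o e)%VF; [apply: CD | rewrite comp_lfunE -linearB; apply: IHs].
Qed.

Lemma comb0 U (C : 'End(U) -> Prop) s : C 0 -> comb C s 0.
Proof.
move=> C0; elim: s => //= v s IHs.
by exists 0; rewrite // zero_lfunE subrr.
Qed.

Lemma comb_span U s (u : U) : u \in <<s>>%VS -> comb (@rhom _ _ U U) s u.
Proof.
elim: s u => [u|v s IHs u]; first by rewrite span_nil memv0 => /eqP.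
rewrite span_cons => /memv_addP[_ /vlineP[c ->] [w ws ->]].
exists (c *: \1%VF); first by apply/homAP/memvZ/homAP/rhom_id.
by rewrite scale_lfunE id_lfunE addrAC subrr add0r; apply: IHs.
Qed.

(* The negated statement says that U = rad(End U) U. *)
Lemma nakayama U : indecomposable U ->
  ~ (forall C : U -> Prop, C 0 -> (forall x y, C x -> C y -> C (x + y)) ->
       (forall e x, singular e -> C (e x)) -> forall u, C u).
Proof.
move=> Ui gen; have [Un0 _] := Ui; apply: Un0.
(* Starting from a K-basis, generators of U over End(U) are removed until none is left. *)
suff drop_gens s : (forall u : U, comb (@rhom _ _ U U) s u) -> zeromod U.
  apply: (drop_gens (vbasis {:U})) => u; apply: comb_span.
  by rewrite (span_basis (vbasisP _)) memvf.
elim: s => [u0|v s IHs vs]; first exact/zeromodP.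
have : comb (@singular U) (v :: s) v.
  apply: gen => [|x y|e x es].
  - by apply/comb0/singular0; case: Ui.
  - by apply: combD => e e'; apply: singularD.
  by apply: comb_map (vs x) => g gr; apply: singular_compr.
move=> [j js vjs]; have [jr jn] := js.
(* Two singular maps cannot sum to the identity, so [1 - j] is invertible; as [v - j v] is a
   combination of [s], so is v. *)
have [|t [tr tj _]] := @endo_inv _ (\1%VF - j) (rhomB (@rhom_id _ _ U) jr).
  apply: contrapT => n1.
  have [_] := singularD Ui (conj (rhomB (@rhom_id _ _ U) jr) n1) js; apply.
  by rewrite subrK; apply/monoP => x y; rewrite !id_lfunE.
have sv : comb (@rhom _ _ U U) s v.
  rewrite -[v]id_lfunE -tj comp_lfunE add_lfunE opp_lfunE id_lfunE.
  by apply: comb_map vjs => e [er _]; apply: rhom_comp.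
apply: IHs => u; have [e er us] := vs u.
rewrite -[u](subrK (e v)); apply: combD => //; first exact: rhomD.
by apply: comb_map sv => g gr; apply: rhom_comp.
Qed.

(** If some composite U -> V -> U is injective, V is the direct sum of im f and ker g, and
    indecomposability forces an isomorphism. Otherwise all such composites are singular, while their
    images span U, against Nakayama's lemma. *)
Lemma indecomposable_Fac_riso U V :
  indecomposable U -> indecomposable V -> Fac U V -> Fac V U -> riso U V.
Proof.
move=> Ui Vi UV VU.
have [[f [g [fr gr gf0]]]|nogf] := pselect (exists (f : 'Hom(U, V)) (g : 'Hom(V, U)),
    [/\ rhom f, rhom g & is_mono (g \o f)%VF]); last first.
  case: (nakayama Ui) => C C0 CD Cs u.
  have Csum (m : nat) (hs : 'I_m -> U) : (forall i, C (hs i)) -> C (\sum_i hs i).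
    by move=> hC; apply: big_ind => // i _.
  have : u \in trace V U by have /Fac_trace-> := VU; rewrite memvf.
  move=> /traceP[k [g [w [gr ->]]]]; apply: (Csum) => i.
  have : w i \in trace U V by have /Fac_trace-> := UV; rewrite memvf.
  move=> /traceP[m [f [x [fr ->]]]]; rewrite linear_sum; apply: Csum => j.
  rewrite /= -comp_lfunE; apply: Cs; split; first exact: rhom_comp.
  by move=> gf0; apply: nogf; exists (f j), (g i).
have f0 : is_mono f.
  apply/monoP => x y fxy; have /monoP := gf0; apply.
  by rewrite !comp_lfunE fxy.
have [||I0|k0] := indecomposable_internal Vi (rhom_limg fr) (rhom_ker gr).
- apply/eqP; rewrite -subv0; apply/subvP => y; rewrite memv_cap memv0.
  move=> /andP[/memv_imgP[x _ ->]]; rewrite memv_ker -comp_lfunE -memv_ker.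
  by rewrite (gf0 : lker _ = _) memv0 => /eqP->; rewrite linear0.
- apply/vspaceP => y; rewrite memvf.
  have /endo_epi/epiP/(_ (g y))[x gfx] := gf0.
  rewrite -[y](subrK (f x)) addrC memv_add ?memv_img ?memvf // memv_ker.
  by rewrite linearB /= -gfx comp_lfunE subrr.
- have [Un0 _] := Ui; case: Un0; apply/zeromodP => x; have /monoP := f0; apply.
  by apply/eqP; rewrite linear0 -memv0 -I0 memv_img ?memvf.
exists f; split=> //; apply/epiP => y.
have g0 : is_mono g by [].
have /endo_epi/epiP/(_ (g y))[x gfx] := gf0.
by exists x; have /monoP := g0; apply; rewrite -gfx comp_lfunE.
Qed.

End Fitting.

(** * Minimal presentations and minimal approximations; rigid generators of functorially finite
    torsion classes *)

Section FunctoriallyFinite.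
Variables (K : fieldType) (A : falgType K).
Implicit Types M N P Q U V W X Y Z : rmod A.

Lemma Fac_trans M N X : Fac M N -> Fac N X -> Fac M X.
Proof.
move=> MN NX; apply/Fac_trace/vspaceP => x; rewrite memvf.
have : x \in trace N X by have /Fac_trace-> := NX; rewrite memvf.
move=> /traceP[k [h [w [hr ->]]]]; apply: memv_suml => i _.
have : w i \in trace M N by have /Fac_trace-> := MN; rewrite memvf.
move=> /traceP[m [e [y [er ->]]]]; rewrite linear_sum; apply: memv_suml => j _.
by rewrite /= -comp_lfunE memv_trace //; apply: rhom_comp.
Qed.

(** Choose an epimorphism from a projective P of least dimension. If Q maps onto X, then [g] lifts
    through Q to an endomorphism [e] of P with [g \o e = g]. The Fitting image of [e] is a summand
    of P that maps onto X, so it is P; and it lies in Q. *)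
Lemma proj_cover_exists X : exists P (g : 'Hom(P, X)), proj_cover g fullv.
Proof.
pose dimP m := `[< exists P (g : 'Hom(P, X)),
  [/\ projective P, rhom g, is_epi g & \dim {:P} = m] >].
have dim_ex : exists m, dimP m.
  have /Fac_power[k [e [er eE]]] := Fac_regmod X.
  exists (\dim {: power_mod (regmod A) k}); apply/asboolP.
  exists (power_mod (regmod A) k), e; split=> //.
  exact/power_projective/regmod_projective.
have [m /asboolP[P [g [Pp gr gE dP]]] m_min] := ex_minnP dim_ex.
exists P, g; split=> // Q sQ gQ.
have [|h hr hE] := projective_lift Pp (rhom_comp (submod_incl_rhom sQ) gr) gr.
  by rewrite limg_comp submod_incl_img gQ subvf.
pose e : 'End(P) := (submod_incl sQ \o h)%VF.
have er : rhom e by apply/rhom_comp/submod_incl_rhom.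
have ge : (g \o e = g)%VF by rewrite comp_lfunA hE.
have [k [E0 EP]] := fitting e; set E := lpow e k.+1 in E0 EP.
have Er : rhom E by apply: lpow_rhom.
have gEg : (g \o E = g)%VF.
  by rewrite /E; elim: k.+1 => [|j IHj]; rewrite ?comp_lfun1r //= comp_lfunA ge.
have sE := rhom_limg Er; have [c cr cE] := corestrict sE Er (subvv _).
have inclr := submod_incl_rhom sE; have /monoP injE := submod_incl_mono sE.
have cx y : submod_incl sE (c y) = E y by rewrite -comp_lfunE cE.
have cir := rhom_comp inclr cr.
(* Restricted to its own image, E is injective, hence invertible; this makes the image a retract of
   P, so projective. *)
have ci0 : is_mono (c \o submod_incl sE)%VF.
  apply/eqP; rewrite -subv0; apply/subvP => x; rewrite memv_ker comp_lfunE memv0.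
  move=> /eqP cx0; rewrite -submod_incl_eq0.
  by rewrite -memv0 -E0 memv_cap submod_inclP memv_ker -cx cx0 linear0 eqxx.
have [t [tr tci _]] := endo_inv cir ci0.
have P'p : projective (submod sE).
  by apply: (retract_projective inclr (rhom_comp cr tr)); rewrite -?comp_lfunA.
have limE : limg E = fullv.
  apply/eqP; rewrite eqEdim subvf -(submod_dim sE) dP m_min //; apply/asboolP.
  exists (submod sE), (g \o submod_incl sE)%VF; split=> //.
    exact: rhom_comp.
  by rewrite /is_epi limg_comp submod_incl_img -limg_comp gEg.
apply/eqP; rewrite eqEsubv subvf -limE /E /= limg_comp.
apply: subv_trans (limgS _ (subvf _)) _.
by rewrite limg_comp -[X in (_ <= X)%VS](submod_incl_img sQ) limgS ?subvf.
Qed.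

Lemma proj_cover_submodule X (W : {vspace X}) : submodule W ->
  exists P (f : 'Hom(P, X)), proj_cover f W.
Proof.
move=> sW; have [P [g [Pp gr gE gmin]]] := proj_cover_exists (submod sW).
exists P, (submod_incl sW \o g)%VF; split=> //.
- exact/rhom_comp/submod_incl_rhom.
- by rewrite limg_comp gE submod_incl_img.
move=> Q sQ; rewrite limg_comp => QW; apply: gmin => //.
apply/vspaceP => x; rewrite memvf.
have : submod_incl sW x \in (submod_incl sW @: (g @: Q))%VS.
  by rewrite QW submod_inclP.
by move=> /memv_imgP[y yQ /(monoP _).1 ->] //; apply: submod_incl_mono.
Qed.

Lemma min_presentation_exists M : exists P1 P0 (f : 'Hom(P1, P0)) (g : 'Hom(P0, M)),
  min_proj_presentation f g.
Proof.
have [P0 [g gP]] := proj_cover_exists M; have [_ gr _ _] := gP.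
have [P1 [f fP]] := proj_cover_submodule (rhom_ker gr).
by exists P1, P0, f, g.
Qed.

(* Via a |-> n a, these are the left T-approximations A -> N. *)
Definition left_approx (T : rmod A -> Prop) N (n : N) : Prop :=
  T N /\ forall X x, T X -> exists2 c : 'Hom(N, X), rhom c & c n = x.

Definition left_minimal N (n : N) : Prop :=
  forall h : 'End(N), rhom h -> h n = n -> is_mono h.

Lemma left_approx_Fac M : exists N (n : N), left_approx (Fac M) n.
Proof.
pose b := vbasis {:M}; pose N := power_mod M (\dim {:M}).
exists N, [ffun i : 'I_(\dim {:M}) => b`_i]; split.
  apply/Fac_power; exists (\dim {:M}), \1%VF.
  by split; [apply: rhom_id | apply: lim1g].
move=> X x /Fac_trace trE; have : x \in trace M X by rewrite trE memvf.
move=> /traceP[k [h [w [hr ->]]]].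
exists (\sum_j \sum_i coord b i (w j) *: (h j \o pproj M i))%VF.
  apply: rhom_sum => j; apply: rhom_sum => i; apply/homAP/memvZ/homAP.
  exact/rhom_comp/hr/pproj_rhom.
rewrite sum_lfunE; apply: eq_bigr => j _.
rewrite [in RHS](coord_vbasis (memvf (w j))) linear_sum sum_lfunE.
apply: eq_bigr => i _.
by rewrite scale_lfunE comp_lfunE pprojE ffunE linearZ.
Qed.

(** For N of least dimension, the image of an endomorphism fixing n is again an approximation, so it
    is all of N. *)
Lemma min_left_approx (T : rmod A -> Prop) :
  torsion_class T -> (exists N (n : N), left_approx T n) ->
  exists N (n : N), left_approx T n /\ left_minimal n.
Proof.
move=> [Tq _] [N0 [n0 N0P]].
pose dimN m := `[< exists N (n : N), left_approx T n /\ \dim {:N} = m >].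
have dim_ex : exists m, dimN m.
  by exists (\dim {:N0}); apply/asboolP; exists N0, n0.
have [m /asboolP[N [n [[TN Nn] dN]]] m_min] := ex_minnP dim_ex.
exists N, n; split=> // h hr hn; apply/endo_epi/eqP.
have sh := rhom_limg hr; have [c cr cE] := corestrict sh hr (subvv _).
rewrite eqEdim subvf -(submod_dim sh) dN m_min //; apply/asboolP.
exists (submod sh), (c n); split=> //; split.
  apply: (Tq _ _ c cr _ TN); apply/epiP => y.
  have /memv_imgP[x _ xE] := submod_inclP y; exists x.
  have /monoP := submod_incl_mono sh; apply.
  by rewrite xE -comp_lfunE cE.
move=> X x TX; have [d dr dn] := Nn X x TX.
exists (d \o submod_incl sh)%VF; first exact/rhom_comp/dr/submod_incl_rhom.
by rewrite comp_lfunE -(comp_lfunE _ c) cE hn.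
Qed.

(** Sending n to a preimage y of n gives c : N -> Y; then [p \o c] fixes n and is invertible by
    minimality. *)
Lemma left_approx_split (T : rmod A -> Prop) N (n : N) Y (p : 'Hom(Y, N)) :
  left_approx T n -> left_minimal n -> T Y -> rhom p -> is_epi p ->
  exists2 s : 'Hom(N, Y), rhom s & (p \o s = \1)%VF.
Proof.
move=> [_ Nn] nmin TY pr /epiP/(_ n)[y py].
have [c cr cn] := Nn Y y TY; have pcr := rhom_comp cr pr.
have [|t [tr _ pct]] := endo_inv pcr.
  by apply: nmin; rewrite ?comp_lfunE ?cn.
by exists (c \o t)%VF; [apply: rhom_comp | rewrite comp_lfunA].
Qed.

Section Extension.
Variables (T : rmod A -> Prop) (P1 P0 N : rmod A).
Variables (f : 'Hom(P1, P0)) (g : 'Hom(P0, N)).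
Hypotheses (Ttors : torsion_class T) (fg : min_proj_presentation f g).
Hypothesis Nsplit : forall Y (p : 'Hom(Y, N)), T Y -> rhom p -> is_epi p ->
  exists2 s : 'Hom(N, Y), rhom s & (p \o s = \1)%VF.
Hypothesis TN : T N.

(* The pushout of k along f is an extension of N by a quotient of X, so it
   splits. *)
Lemma extend_mod_kernel X (k : 'Hom(P1, X)) : T X -> rhom k ->
  exists2 l : 'Hom(P0, X), rhom l & (limg (k - (l \o f)%VF) <= k @: lker f)%VS.
Proof.
have [[P1p P0p] fr gr gE fgE] := min_presentation_presentation fg.
move=> TX kr; have [Tq Te] := Ttors.
have gf z : g (f z) = 0 by apply/eqP; rewrite -memv_ker -fgE memv_img ?memvf.
(* The pushout Y is the cokernel of (k, -f), with structure maps [i] and [j]; [i] need not be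
   injective, as [f] need not be. *)
pose D := ((dinl X P0 \o k) - (dinr X P0 \o f))%VF.
have Dr : rhom D.
  by apply: rhomB; apply: rhom_comp => //; [apply: dinl_rhom | apply: dinr_rhom].
have DE z : D z = (k z, - f z).
  rewrite add_lfunE opp_lfunE !comp_lfunE dinlE dinrE.
  by congr pair; rewrite /= ?oppr0 ?addr0 ?add0r.
have [Y [q [qr qE qk]]] := quotient_exists (rhom_limg Dr).
have q0 x y : q (x, y) = 0 -> exists2 z, x = k z & y = - f z.
  move/eqP; rewrite -memv_ker qk => /memv_imgP[z _]; rewrite DE => -[-> ->].
  by exists z.
pose i := (q \o dinl X P0)%VF; have ir : rhom i by apply/rhom_comp/qr/dinl_rhom.
pose j := (q \o dinr X P0)%VF; have jr : rhom j by apply/rhom_comp/qr/dinr_rhom.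
have qij x y : q (x, y) = i x + j y.
  by rewrite (dsum_split (x, y)) linearD /= !comp_lfunE.
have jf z : j (f z) = i (k z).
  apply/eqP; rewrite eq_sym -subr_eq0 -linearN -qij -DE -memv_ker qk.
  by rewrite memv_img ?memvf.
have [|p pr pq] := factor_epi qr qE (rhom_comp (@dsnd_rhom _ _ X P0) gr).
  rewrite qk; apply/subvP => _ /memv_imgP[z _ ->].
  by rewrite memv_ker comp_lfunE dsndE DE linearN /= gf oppr0.
have pij x y : p (i x + j y) = g y.
  by rewrite -qij -comp_lfunE pq comp_lfunE dsndE.
have YE u : exists x y, u = i x + j y.
  by have /epiP/(_ u)[[x y] <-] := qE; exists x, y.
have pE : is_epi p.
  by apply/epiP => y; have /epiP/(_ y)[x <-] := gE; exists (i 0 + j x).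
have sI := rhom_limg ir; have pk : lker p = limg i.
  apply/vspaceP => u; have [x [y ->]] := YE u; rewrite memv_ker pij.
  apply/idP/memv_imgP => [|[z _ ijE]].
    rewrite -memv_ker -fgE => /memv_imgP[z _ ->].
    by exists (x + k z); rewrite ?memvf // linearD jf.
  by rewrite -(pij x) ijE -[i z]addr0 -(linear0 j) pij linear0.
have TI : T (submod sI).
  have [c cr cE] := corestrict sI ir (subvv _); apply: (Tq _ _ c cr _ TX).
  apply/epiP => u; have /memv_imgP[x _ xE] := submod_inclP u; exists x.
  have /monoP := submod_incl_mono sI; apply.
  by rewrite xE -[in RHS]cE comp_lfunE.
have TY : T Y.
  apply: (Te _ _ _ _ _ (submod_incl_rhom sI) pr (submod_incl_mono sI) pE) => //.
  by rewrite submod_incl_img pk.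
have [s sr ps] := Nsplit TY pr pE.
(* [j] and [s \o g] agree after [p], so their difference lands in ker p = im i and lifts to [l]
   through [i]. *)
have dr : rhom (j - (s \o g)%VF) by apply/rhomB/rhom_comp.
have [|l lr lE] := projective_lift P0p ir dr.
  rewrite -pk; apply/subvP => _ /memv_imgP[y _ ->].
  rewrite memv_ker add_lfunE opp_lfunE (comp_lfunE s) linearB /=.
  rewrite -(comp_lfunE p s) ps.
  by rewrite id_lfunE -[j y]add0r -(linear0 i) pij subrr.
exists l => //; apply/subvP => _ /memv_imgP[z _ ->].
(* An x killed by [i] gives a pair (x, 0) in the image of (k, -f), so x = k z' with f z' = 0. *)
set x := _ z; suff: q (x, 0) = 0.
  move=> /q0[z' -> /esym/eqP].
  by rewrite oppr_eq0 -memv_ker => z'k; rewrite memv_img.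
rewrite qij linear0 addr0 /x.
rewrite add_lfunE opp_lfunE (comp_lfunE l) linearB /= -(comp_lfunE i l) lE.
by rewrite add_lfunE opp_lfunE (comp_lfunE s) gf linear0 subr0 jf subrr.
Qed.

(* Iterating extend_mod_kernel, the image of k strictly decreases because
   lker f is superfluous in P1. *)
Lemma extendable_torsion X : T X -> extendable f X.
Proof.
move=> TX k; have [m] := ubnP (\dim (limg k)).
elim: m k => // m IHm k le_m kr; have [_ fP] := fg.
have [->|kn0] := eqVneq k 0.
  by exists 0; [apply: rhom0 | apply: comp_lfun0l].
have [l lr kl] := extend_mod_kernel TX kr.
have fr : rhom f by case: fP.
have [||l' l'r l'E] := IHm (k - (l \o f)%VF); last first.
- exists (l' + l); first exact: rhomD.
  by rewrite comp_lfunDl l'E subrK.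
- exact/rhomB/rhom_comp.
rewrite ltnS in le_m; apply: leq_trans le_m; apply: leq_ltn_trans (dimvS kl) _.
(* Equal dimensions would give P1 = ker k + ker f, so ker k = P1 and k = 0. *)
rewrite ltn_neqAle dimvS ?limgS ?subvf // andbT; apply: contra kn0 => dE.
have kE : (k @: lker f)%VS = limg k.
  by apply/eqP; rewrite eqEdim limgS ?subvf // (eqP dE) leqnn.
have kk : lker k = fullv.
  apply: (superfluous_img fP (@rhom_id _ _ P1) (rhom_ker kr)).
  rewrite lim1g; apply/vspaceP => z; rewrite memvf.
  have /memv_imgP[z' z'f kz] : k z \in (k @: lker f)%VS.
    by rewrite kE memv_img ?memvf.
  rewrite -[z](subrK z') memv_add // memv_ker linearB /= kz subrr //.
by apply/eqP/lfunP => z; apply/eqP; rewrite zero_lfunE -memv_ker kk memvf.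
Qed.

End Extension.

(** A given generator M of T may fail to be rigid. It is replaced by the target N of a minimal
    approximation, onto which every epimorphism from T splits; every x in a module of T is an image
    of n, so N generates T. *)
Lemma functorially_finite_presentation (T : rmod A -> Prop) :
  torsion_class T -> functorially_finite T ->
  exists P1 P0 N (f : 'Hom(P1, P0)) (g : 'Hom(P0, N)),
    [/\ presentation f g, extendable f N & same_class T (Fac N)].
Proof.
move=> Ttors [M TM].
have [|N [n [nT nmin]]] := min_left_approx Ttors.
  have [N [n [FN Fn]]] := left_approx_Fac M; exists N, n; split; first exact/TM.
  by move=> X x /TM; apply: Fn.
have [TN Nn] := nT; have [P1 [P0 [f [g fg]]]] := min_presentation_exists N.
exists P1, P0, N, f, g; split; first exact: min_presentation_presentation.
  apply: (extendable_torsion Ttors fg _ TN TN) => Y p TY pr pE.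
  exact: left_approx_split nT nmin TY pr pE.
move=> X; split=> [TX|NX]; last first.
  by apply/TM/Fac_trans/NX/TM.
apply/Fac_trace/vspaceP => x; rewrite memvf.
by have [c cr <-] := Nn X x TX; apply: memv_trace.
Qed.

End FunctoriallyFinite.

(** * Consequences of equal Newton polytopes and the five statements *)

Section Main.
Variables (K : fieldType) (A : falgType K) (R : realType).
Variables (n : nat) (S : 'I_n -> rmod A) (S_reps : simple_reps S).
Variables (U V : rmod A).
Hypothesis eqN : newton R S U = newton R S V.

Lemma tau_rigid_Fac_newton (M : rmod A) : tau_rigid M -> Fac M U -> Fac M V.
Proof.
move=> /tau_rigidP[P1 [P0 [f [g [fg fM]]]]].
exact: (Fac_newton S_reps (min_presentation_presentation fg) fM eqN).
Qed.

Lemma left_finite_tors_newton : left_finite U -> tors U V.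
Proof.
move=> Uf; have [P1 [P0 [N [f [g [fg fN TN]]]]]] :=
  functorially_finite_presentation (tors_torsion_class U) Uf.
by apply/TN; apply: (Fac_newton S_reps fg fN eqN); apply/TN.
Qed.

End Main.

Lemma tors_sub (K : fieldType) (A : falgType K) (M N X : rmod A) :
  tors M N -> tors N X -> tors M X.
Proof. by move=> MN NX T Tt TM; apply: NX => //; apply: MN. Qed.

Theorem theorem1p6 (K : fieldType) (A : falgType K) (basicA : basic_algebra A)
    (R : realType) (n : nat) (S : 'I_n -> rmod A) (S_reps : simple_reps S)
    (U V : rmod A) (eqN : newton R S U = newton R S V) :
  [/\ forall M P : rmod A, tau_tilting_pair M P -> (Fac M U <-> Fac M V),
      left_finite U -> left_finite V -> same_class (tors U) (tors V),
      left_finite U -> brick U -> left_finite V -> brick V -> riso U V,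
      indecomposable U -> tau_rigid U -> indecomposable V -> tau_rigid V ->
        riso U V
    & tau_rigid U -> tau_rigid V -> tau_rigid (dsum U V)].
Proof.
have UV := tau_rigid_Fac_newton S_reps eqN.
have VU := tau_rigid_Fac_newton S_reps (esym eqN).
have torsUV := left_finite_tors_newton S_reps eqN.
have torsVU := left_finite_tors_newton S_reps (esym eqN).
split.
- by move=> M P [[_ Mr _] _]; split; [apply: UV | apply: VU].
- move=> Uf Vf X; split=> [UX|VX].
    exact: tors_sub (torsVU Vf) UX.
  exact: tors_sub (torsUV Uf) VX.
- by move=> Uf Ub Vf Vb; apply: brick_riso Ub Vb (torsUV Uf) (torsVU Vf).
- move=> Ui Ur Vi Vr; apply: indecomposable_Fac_riso => //.
    exact/UV/Fac_refl.
  exact/VU/Fac_refl.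
(* Each of U and V lies in Fac of the other, so maps into either one extend along both minimal
   presentations. *)
move=> Ur Vr; have FUV := UV _ Ur (Fac_refl U); have FVU := VU _ Vr (Fac_refl V).
have [P1 [P0 [f [g [fg fU]]]]] := (tau_rigidP U).1 Ur.
have [Q1 [Q0 [f' [g' [fg' fV]]]]] := (tau_rigidP V).1 Vr.
have [[P1p _] _ _ _ _] := min_presentation_presentation fg.
have [[Q1p _] _ _ _ _] := min_presentation_presentation fg'.
apply: (tau_rigid_dsum_of fg fg'); apply: extendable_dsum => //.
  exact: extendable_Fac FUV.
exact: extendable_Fac FVU.
Qed.
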